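(* Let $R(f)=\frac12\|f\|^2$ and assume in addition that $|\mathcal{L}'(a)-\mathcal{L}'(b)|\le c_4|a-b|$ for all $a,b\in\mathbb{R}$. There is a constant $\beta^B_{prim}>0$, depending only on $C^R$, $c_4$, $\eta$, $N_p$ (not on $d$, $\delta$, $\alpha_{acc}$, $\alpha$, $f^0$, $B_p$ or $\mathbb{P}^{xy}$), such that the following holds. Let $f^0\in\mathbb{R}^d\setminus\{0\}$, $\alpha_{acc}\in(0,1]$, $\alpha\in(0,1]$, $\delta\in(0,1/2)$, $\rho=\alpha_{acc}/\|f^0\|^2$, and let $D_p$, $f_p(t),f_i(t)$, $\epsilon_p,\epsilon_i$, $\zeta=\frac{\rho B_p\alpha}{2C^R}$ and $f^*_p$ be as follows: $D_p$ consists of $B_p$ i.i.d. samples from $\mathbb{P}^{xy}$; $f_p(t),f_i(t)\in\mathbb{R}^d$ ($i\in\mathcal{N}_p$, $|\mathcal{N}_p|=N_p$) are fixed; $\epsilon_p,\epsilon_i$ are random vectors independent of $D_p$ each with density proportional to $e^{-\zeta\|\cdot\|}$; $\epsilon^{pi}=\epsilon_p-\epsilon_i$; and $f^*_p=\arg\min_f\big(Z_p(f\mid D_p)-\eta\sum_{i\in\mathcal{N}_p}((f-\tfrac12(f_p(t)+f_i(t)))^T\epsilon^{pi}+\tfrac14\|\epsilon^{pi}\|^2)\big)$. Let $\xi$ be a random vector independent of $D_p$ with density proportional to $e^{-\zeta\|\xi\|}$ and $V^*_p=f^*_p+\xi$. If $$B_p>\beta^B_{prim}\max\Big(\frac{C^R\|f^0\|^3\eta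 N_pd\ln(\frac d\delta)}{\alpha_{acc}^2\alpha},\ \frac{C^R\|f^0\|^2\ln(\frac1\delta)}{\alpha_{acc}^2},\ \frac{4C^R\|f^0\|d(\ln(\frac d\delta))^2}{\alpha_{acc}\alpha},\ \frac{4\|f^0\|^3\eta N_pd\ln(\frac d\delta)}{\alpha_{acc}^2\alpha},\ \frac{4(C^R)^{3/2}\|f^0\|^2d\ln(\frac d\delta)}{\alpha_{acc}^{3/2}\alpha}\Big),$$ then $\mathbb{P}\big(\hat C(V^*_p)\le\hat C(f^0)+\alpha_{acc}\big)\ge1-3\delta$.
   Context: $\mathbb{P}^{xy}$ is a probability distribution on $\{x\in\mathbb{R}^d:\|x\|\le1\}\times\{-1,1\}$. The loss $\mathcal{L}:\mathbb{R}\to\mathbb{R}$ is convex and differentiable with $|\mathcal{L}'|\le1$. $C^R>0$, $\eta>0$, $N_p\ge1$ an integer. $Z_p(f\mid D_p)=\frac{C^R}{B_p}\sum_{j=1}^{B_p}\mathcal{L}(y_jf^Tx_j)+\rho R(f)$ for $D_p=((x_j,y_j))_{j=1}^{B_p}$. The expected loss is $\hat C(f)=C^R\,\mathbb{E}_{(x,y)\sim\mathbb{P}^{xy}}[\mathcal{L}(yf^Tx)]$. *)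

(* Defs.v *)
From HB Require Import structures.
From mathcomp Require Import all_boot all_order all_algebra.
From mathcomp Require Import all_classical all_reals all_analysis.
Set Implicit Arguments. Unset Strict Implicit. Unset Printing Implicit Defensive.
Import Order.TTheory GRing.Theory Num.Theory.
Local Open Scope classical_set_scope.
Local Open Scope ring_scope.

Section Defs.
Variable R : realType.

(* conversions between row vectors (used for arithmetic) and tuples
   (which carry MathComp-Analysis' product sigma-algebra of Borel sets) *)
Definition rv2t (d : nat) (v : 'rV[R]_d) : d.-tuple R := [tuple v ord0 i | i < d].
Definition t2rv (d : nat) (t : d.-tuple R) : 'rV[R]_d := \row_i tnth t i.

Definition dotp (d : nat) (u v : 'rV[R]_d) : R := \sum_(i < d) u ord0 i * v ord0 i.
Definition enorm (d : nat) (v : 'rV[R]_d) : R := Num.sqrt (dotp v v).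

(* iterated one-dimensional Lebesgue integral over R^d (= d.-tuple R) of a
   function with values in the extended reals; for nonnegative measurable
   integrands this is the integral w.r.t. the d-dimensional Lebesgue measure
   (Tonelli). *)
Fixpoint iter_lebesgue_integral (n : nat) : (n.-tuple R -> \bar R) -> \bar R :=
  match n return (n.-tuple R -> \bar R) -> \bar R with
  | 0 => fun g => g [tuple]
  | n'.+1 => fun g =>
      (\int[@lebesgue_measure R]_t
         iter_lebesgue_integral (fun v : n'.-tuple R => g [tuple of t :: v]))%E
  end.

Definition has_density_prop_to d0 (T : measurableType d0) (P : probability T R)
  (d : nat) (X : T -> 'rV[R]_d) (dens : 'rV[R]_d -> R) : Prop :=
  exists c : R, forall A : set (d.-tuple R), measurable A ->
    P ((@rv2t d \o X) @^-1` A) =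
    (c%:E * iter_lebesgue_integral
              (fun t => (\1_A t * dens (t2rv t))%:E))%E.

Definition indep2 d0 (T : measurableType d0) (P : probability T R)
  d1 (T1 : measurableType d1) d2 (T2 : measurableType d2)
  (X : T -> T1) (Y : T -> T2) : Prop :=
  forall (A : set T1) (B : set T2), measurable A -> measurable B ->
    P (X @^-1` A `&` Y @^-1` B) = (P (X @^-1` A) * P (Y @^-1` B))%E.

Definition mutually_indep d0 (T : measurableType d0) (P : probability T R)
  (I : finType) d1 (T1 : measurableType d1) (X : I -> T -> T1) : Prop :=
  forall (J : {set I}) (A : I -> set T1), (forall i, measurable (A i)) ->
    P (\big[setI/setT]_(i in J) (X i @^-1` A i)) =
    (\big[*%E/1%E]_(i in J) P (X i @^-1` A i))%E.

End Defs.

(* Main.v *)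
Require Import Defs.
From HB Require Import structures.
From mathcomp Require Import all_boot all_order all_algebra.
From mathcomp Require Import all_classical all_reals all_analysis.
From mathcomp Require Import measurable_realfun zify ring lra.
Set Implicit Arguments. Unset Strict Implicit. Unset Printing Implicit Defensive.
Import Order.TTheory GRing.Theory Num.Theory.
Local Open Scope classical_set_scope.
Local Open Scope ring_scope.

(** The loss of [f] at [(x, y)] depends only on [f . v] with [v = y x] in the unit
    ball.  Adding the ridge term makes the population objective [F] strongly
    convex; let [p] be a near-minimizer of [F] and [r = |f0|], so that
    [rho * r ^ 2 = alpha_acc].  On the ball of centre [p] and radius [r] the
    empirical and population losses deviate by a small multiple of [alpha_acc],
    with probability [1 - delta] and independently of the dimension: exponential
    symmetrization and the contraction principle reduce the deviation to the
    exponential moment of the norm of a Rademacher sum of unit vectors.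

    Tilting the empirical objective by [- eta f . W] moves its minimizer [f*]:
    convexity keeps it in the ball, where [F f* <= F p + eta |W| r + deviation].
    Smoothness of the loss makes the output noise [xi] a second-order effect,
    since [F (f* + xi) + F (f* - xi) - 2 F f*] is at most a multiple of [|xi| ^ 2]
    and [F (f* - xi)] is at least [F p], up to the near-minimality error.

    The noise norms are controlled by halving the rate of the density, which
    gives [P (|eps| > t) <= 2 ^ d * exp (- zeta t / 2)]; only the marginal laws of
    the noises enter, and the deviation bound is uniform in [f], so their
    dependence on each other and on the data is irrelevant. *)

(** * Euclidean norm and exponential inequalities *)

Section Euclid.
Variables (R : realType) (d : nat).
Implicit Types (u v w : 'rV[R]_d) (a : R).

Lemma dotpC u v : dotp u v = dotp v u.
Proof. by apply: eq_bigr => i _; rewrite mulrC. Qed.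

Lemma dotpDl u v w : dotp (u + v) w = dotp u w + dotp v w.
Proof. by rewrite /dotp -big_split; apply: eq_bigr => i _; rewrite mxE mulrDl. Qed.

Lemma dotpZl a u w : dotp (a *: u) w = a * dotp u w.
Proof. by rewrite /dotp big_distrr /=; apply: eq_bigr => i _; rewrite mxE mulrA. Qed.

Lemma dotpNl u w : dotp (- u) w = - dotp u w.
Proof. by rewrite -scaleN1r dotpZl mulN1r. Qed.

Lemma dotpBl u v w : dotp (u - v) w = dotp u w - dotp v w.
Proof. by rewrite dotpDl dotpNl. Qed.

Lemma dotp0l w : dotp 0 w = 0.
Proof. by rewrite -(scale0r 0) dotpZl mul0r. Qed.

Lemma dotpDr w u v : dotp w (u + v) = dotp w u + dotp w v.
Proof. by rewrite !(dotpC w) dotpDl. Qed.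

Lemma dotpZr a u w : dotp w (a *: u) = a * dotp w u.
Proof. by rewrite !(dotpC w) dotpZl. Qed.

Lemma dotpNr u w : dotp w (- u) = - dotp w u.
Proof. by rewrite !(dotpC w) dotpNl. Qed.

Lemma dotpBr w u v : dotp w (u - v) = dotp w u - dotp w v.
Proof. by rewrite dotpDr dotpNr. Qed.

Lemma dotp0r w : dotp w 0 = 0.
Proof. by rewrite dotpC dotp0l. Qed.

Lemma dotp_sumr (I : Type) (s : seq I) (F : I -> 'rV[R]_d) w :
  dotp w (\sum_(i <- s) F i) = \sum_(i <- s) dotp w (F i).
Proof.
elim: s => [|i s ih]; first by rewrite !big_nil dotp0r.
by rewrite !big_cons dotpDr ih.
Qed.

Lemma dotp_ge0 u : 0 <= dotp u u.
Proof. by apply: sumr_ge0 => i _; rewrite -expr2 sqr_ge0. Qed.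

Lemma enorm_ge0 u : 0 <= enorm u.
Proof. exact: sqrtr_ge0. Qed.

Lemma sqr_enorm u : enorm u ^+ 2 = dotp u u.
Proof. by rewrite sqr_sqrtr // dotp_ge0. Qed.

Lemma enorm0 : enorm (0 : 'rV[R]_d) = 0.
Proof. by rewrite /enorm dotp0l sqrtr0. Qed.

Lemma enorm_eq0 u : (enorm u == 0) = (u == 0).
Proof.
apply/eqP/eqP => [/eqP|->]; last exact: enorm0.
rewrite sqrtr_eq0 => u0; apply/rowP => i; rewrite mxE.
have /eqP : dotp u u = 0 by apply/eqP; rewrite eq_le u0 dotp_ge0.
rewrite psumr_eq0 => [|j _]; last by rewrite -expr2 sqr_ge0.
by move/allP/(_ i (mem_index_enum _))/implyP/(_ isT); rewrite -expr2 sqrf_eq0 => /eqP.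
Qed.

Lemma enormZ a u : enorm (a *: u) = `|a| * enorm u.
Proof.
by rewrite /enorm dotpZl dotpZr mulrA -expr2 sqrtrM ?sqr_ge0 // sqrtr_sqr.
Qed.

Lemma enormN u : enorm (- u) = enorm u.
Proof. by rewrite -scaleN1r enormZ normrN1 mul1r. Qed.

Lemma cauchy_schwarz u v : `|dotp u v| <= enorm u * enorm v.
Proof.
have [/eqP|v0] := boolP (enorm v == 0).
  by move=> v0; move/eqP: (v0); rewrite enorm_eq0 => /eqP ->; rewrite dotp0r normr0 enorm0 mulr0.
have vv : 0 < dotp v v by rewrite -sqr_enorm exprn_gt0 // lt_def v0 enorm_ge0.
rewrite -(ler_pXn2r (n := 2)) ?nnegrE ?mulr_ge0 ?enorm_ge0 //.
rewrite exprMn !sqr_enorm real_normK ?num_real //.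
have := dotp_ge0 (dotp v v *: u - dotp u v *: v).
rewrite !(dotpBl, dotpBr, dotpZl, dotpZr) (dotpC v u).
rewrite [X in 0 <= X](_ : _ = dotp v v * (dotp u u * dotp v v - dotp u v ^+ 2)); last by ring.
by rewrite pmulr_rge0 // subr_ge0.
Qed.

Lemma dotp_le_enorm u v : dotp u v <= enorm u * enorm v.
Proof. exact: le_trans (ler_norm _) (cauchy_schwarz u v). Qed.

Lemma sqr_enormD u v :
  enorm (u + v) ^+ 2 = enorm u ^+ 2 + 2 * dotp u v + enorm v ^+ 2.
Proof. by rewrite !sqr_enorm !(dotpDl, dotpDr) (dotpC v u); ring. Qed.

Lemma ler_enormD u v : enorm (u + v) <= enorm u + enorm v.
Proof.
rewrite -(ler_pXn2r (n := 2)) ?nnegrE ?addr_ge0 ?enorm_ge0 //.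
by rewrite sqr_enormD; have := dotp_le_enorm u v; lra.
Qed.

Lemma ler_enorm_sum (I : Type) (s : seq I) (F : I -> 'rV[R]_d) :
  enorm (\sum_(i <- s) F i) <= \sum_(i <- s) enorm (F i).
Proof.
elim: s => [|i s ih]; first by rewrite !big_nil enorm0.
by rewrite !big_cons (le_trans (ler_enormD _ _)) // lerD2l.
Qed.

Lemma enorm_coord u i : `|u ord0 i| <= enorm u.
Proof.
rewrite -(ler_pXn2r (n := 2)) ?nnegrE ?enorm_ge0 // sqr_enorm real_normK ?num_real //.
rewrite /dotp (bigD1 i) //= -expr2 lerDl.
by apply: sumr_ge0 => j _; rewrite -expr2 sqr_ge0.
Qed.

Lemma enorm_le_coord u a : (forall i, `|u ord0 i| <= a) -> enorm u <= d%:R * a.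
Proof.
move=> ua; rewrite [u]row_sum_delta (le_trans (ler_enorm_sum _ _)) //.
rewrite mulr_natl -[X in _ *+ X]card_ord -sumr_const ler_sum // => i _.
rewrite enormZ (_ : enorm _ = 1) ?mulr1 //.
rewrite /enorm /dotp (bigD1 i) //= big1 => [|j ji].
  by rewrite !mxE !eqxx mulr1 addr0 sqrtr1.
by rewrite !mxE eqxx (negPf ji) mulr0.
Qed.

End Euclid.

Section ExpIneq.
Variable R : realType.
Implicit Types x y a b c : R.

(* On [0, 1] everything reduces to [1 + t <= expR t] applied at [x / 2], [- x / 2]. *)
Lemma cosh_le_expR_sqr x : (expR x + expR (- x)) / 2 <= expR (x ^+ 2).
Proof.
wlog x0 : x / 0 <= x => [H|].
  have [/H//|x0] := leP 0 x.
  by have := H (- x); rewrite oppr_ge0 (ltW x0) opprK sqrrN addrC => /(_ isT).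
have [x1|x1] := leP 1 x.
  have xx : x <= x ^+ 2 by rewrite expr2 ler_peMl.
  have : expR x <= expR (x ^+ 2) by rewrite ler_expR.
  have : expR (- x) <= expR x by rewrite ler_expR; lra.
  lra.
(* This is the square of [1 - y / 2 <= expR (- (y / 2))] multiplied through by [expR y]. *)
have bnd y : `|y| < 1 -> expR y * (1 - y / 2) ^+ 2 <= 1.
  move=> /ltr_normlP[y1 y2].
  rewrite (_ : y = y / 2 + y / 2) ?expRD; last by lra.
  rewrite (_ : (y / 2 + y / 2) / 2 = y / 2); last by lra.
  have e1 : (1 - y / 2) <= expR (- (y / 2)) by exact: expR_ge1Dx.
  have e2 : expR (y / 2) * (1 - y / 2) <= 1.
    by rewrite -[leRHS](expRxMexpNx_1 (y / 2)) ler_pM2l // expR_gt0.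
  have e3 : 0 <= expR (y / 2) * (1 - y / 2).
    by apply: mulr_ge0; [exact: expR_ge0|lra].
  rewrite [leLHS](_ : _ = (expR (y / 2) * (1 - y / 2)) ^+ 2); last by ring.
  by rewrite expr_le1.
have nx : `|x| < 1 by rewrite ger0_norm.
have b1 := bnd _ nx.
have b2 : expR (- x) * (1 + x / 2) ^+ 2 <= 1.
  by have := bnd (- x); rewrite normrN mulNr opprK; exact.
(* With [q = (x / 2) ^ 2], the two bounds give [cosh x <= (1 + q) / (1 - q) ^ 2]. For [q <= 1 / 4],
   [1 / (1 - q) <= expR (4 / 3 * q)], so the total exponent is [11 / 3 * q <= 4 * q = x ^ 2]. *)
set q := x ^+ 2 / 4.
have q0 : 0 <= q by rewrite divr_ge0 // sqr_ge0.
have q1 : q <= 1 / 4 by rewrite /q; have := exprn_ile1 2 x0 (ltW x1); lra.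
have p1 : 0 < 1 - x / 2 by lra.
have p2 : 0 < 1 + x / 2 by lra.
have step1 : (expR x + expR (- x)) / 2 * (1 - q) ^+ 2 <= 1 + q.
  have -> : (1 - q) ^+ 2 = (1 - x / 2) ^+ 2 * (1 + x / 2) ^+ 2 by rewrite /q; field.
  have : expR x * ((1 - x / 2) ^+ 2 * (1 + x / 2) ^+ 2) <= (1 + x / 2) ^+ 2.
    by rewrite mulrA ler_piMl // sqr_ge0.
  have : expR (- x) * ((1 - x / 2) ^+ 2 * (1 + x / 2) ^+ 2) <= (1 - x / 2) ^+ 2.
    by rewrite mulrCA ler_piMr // sqr_ge0.
  rewrite (_ : 1 + q = ((1 + x / 2) ^+ 2 + (1 - x / 2) ^+ 2) / 2); last by rewrite /q; field.
  lra.
have step2 : 1 <= expR (4 / 3 * q) * (1 - q).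
  have : 1 + 4 / 3 * q <= expR (4 / 3 * q) by exact: expR_ge1Dx.
  move=> h; apply: (@le_trans _ _ ((1 + 4 / 3 * q) * (1 - q))); last by rewrite ler_wpM2r //; lra.
  nra.
have step3 : 1 <= expR (4 / 3 * q) ^+ 2 * (1 - q) ^+ 2.
  by rewrite -exprMn expr_ge1 // (le_trans ler01).
have step4 : 1 + q <= expR q by exact: expR_ge1Dx.
set C := (expR x + expR (- x)) / 2 in step1 *.
have C0 : 0 <= C by rewrite /C divr_ge0 // addr_ge0 ?expR_ge0.
apply: (@le_trans _ _ (C * (1 - q) ^+ 2 * expR (4 / 3 * q) ^+ 2)).
  by rewrite -mulrA ler_peMr // mulrC.
apply: (@le_trans _ _ (expR q * expR (4 / 3 * q) ^+ 2)).
  by rewrite ler_wpM2r ?sqr_ge0 // (le_trans step1).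
rewrite -expRM_natl -expRD ler_expR /q.
have : 0 <= x ^+ 2 by exact: sqr_ge0.
lra.
Qed.

(** Factoring out the exponential of the midpoint leaves the hyperbolic cosine of the
    half-difference. *)
Lemma expR_avg a b :
  (expR a + expR b) / 2 <= expR ((a + b) / 2) * expR (((a - b) / 2) ^+ 2).
Proof.
apply: (le_trans _ (ler_wpM2l (expR_ge0 _) (cosh_le_expR_sqr _))).
rewrite mulrA mulrDr -!expRD.
rewrite (_ : (a + b) / 2 + (a - b) / 2 = a); last by lra.
by rewrite (_ : (a + b) / 2 + - ((a - b) / 2) = b) //; lra.
Qed.

Lemma expR_mid_le a b : expR ((a + b) / 2) <= (expR a + expR b) / 2.
Proof.
have h1 := expR_ge1Dx ((a - b) / 2); have h2 := expR_ge1Dx ((b - a) / 2).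
set m := (a + b) / 2.
have -> : expR a = expR m * expR ((a - b) / 2) by rewrite -expRD /m; congr expR; lra.
have -> : expR b = expR m * expR ((b - a) / 2) by rewrite -expRD /m; congr expR; lra.
rewrite -mulrDr -mulrA ler_peMr ?expR_ge0 //; lra.
Qed.

Lemma expR_cosh_le x y : `|x| <= `|y| ->
  expR x + expR (- x) <= expR y + expR (- y).
Proof.
have H (u v : R) : 0 <= u -> u <= v -> expR u + expR (- u) <= expR v + expR (- v).
  move=> u0 uv.
  have e1 : 1 <= expR (v - u) by rewrite -expR0 ler_expR subr_ge0.
  have e2 : 1 <= expR (u + v) by rewrite -expR0 ler_expR; lra.
  (* The difference of the two sides factors as [expR (- v) * (expR (v - u) - 1) * (expR (u + v) -
     1)]. *)
  have := mulr_ge0 (mulr_ge0 (expR_ge0 (- v)) (le_trans ler01 e1)) (mulr_ge0 (_ : 0 <= expR (v - u) - 1) (_ : 0 <= expR (u + v) - 1)).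
  rewrite !subr_ge0 => /(_ e1 e2).
  have -> : expR (- v) * expR (v - u) * ((expR (v - u) - 1) * (expR (u + v) - 1))
     = expR (v - u) * (expR v + expR (- v) - (expR u + expR (- u))).
    have -> : expR (v - u) = expR v * expR (- u) by rewrite expRD.
    have -> : expR (u + v) = expR u * expR v by rewrite expRD.
    rewrite !expRN; field.
    by rewrite !gt_eqF ?expR_gt0.
  by rewrite pmulr_rge0 ?expR_gt0 // subr_ge0.
have K (z : R) : expR z + expR (- z) = expR `|z| + expR (- `|z|).
  by case: (ger0P z) => // _; rewrite opprK addrC.
by move=> xy; rewrite (K x) (K y); exact: H.
Qed.

(** The increment is [expR a * (expR x - 1)], a product of nonnegative factors that increase with
    [a] and with [x]. *)
Lemma expR_gap_le a b x y : a <= b -> 0 <= x -> x <= y ->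
  expR (a + x) - expR a <= expR (b + y) - expR b.
Proof.
move=> ab x0 xy.
rewrite !expRD -[X in _ - X]mulr1 -[X in _ <= _ - X]mulr1 -!mulrBr.
apply: ler_pM; rewrite ?expR_ge0 ?subr_ge0 -?expR0 ?ler_expR //.
by rewrite lerB // ler_expR.
Qed.

(* Two-point comparison inequality behind the Ledoux-Talagrand contraction
   principle, for the convex function [expR]: here [x, y] are the values of the
   contraction at two indices, and [X, Y] those of the original process. *)
Lemma expR_contraction a c x y X Y M N :
  `|x - y| <= `|X - Y| -> `|x| <= `|X| -> `|y| <= `|Y| ->
  expR (a + X) <= M -> expR (c + Y) <= M ->
  expR (a - X) <= N -> expR (c - Y) <= N ->
  expR (a + x) + expR (c - y) <= M + N.
Proof.
move=> xyXY xX yY MX MY NX NY.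
(* If one index dominates both exponentials on the left, everything is charged to that index and the
   claim is the monotonicity of cosh. The mixed case, with [c + y <= a + x] and [a - x <= c - y],
   remains. *)
have [lt1|ge1] := ltP (expR (a + x)) (expR (c + y)).
  apply: (@le_trans _ _ (expR (c + y) + expR (c - y))); first by rewrite lerD2r ltW.
  apply: (@le_trans _ _ (expR (c + Y) + expR (c - Y))); last exact: lerD.
  by rewrite !(expRD c) -!mulrDr ler_pM2l ?expR_gt0 // expR_cosh_le.
have [lt2|ge2] := ltP (expR (c - y)) (expR (a - x)).
  apply: (@le_trans _ _ (expR (a + x) + expR (a - x))); first by rewrite lerD2l ltW.
  apply: (@le_trans _ _ (expR (a + X) + expR (a - X))); last exact: lerD.
  by rewrite !(expRD a) -!mulrDr ler_pM2l ?expR_gt0 // expR_cosh_le.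
move: ge1 ge2; rewrite !ler_expR => ge1 ge2.
wlog X0 : X Y M N xyXY xX yY MX MY NX NY / 0 <= X => [H|].
  have [X0|X0] := leP 0 X; first exact: (H X Y).
  rewrite [M + N]addrC; apply: (H (- X) (- Y) N M); rewrite ?normrN ?opprK //.
  - by rewrite [- X + Y]addrC [`|Y - X|]distrC.
  - by rewrite oppr_ge0 ltW.
rewrite (ger0_norm X0) in xX.
have /andP[xX1 xX2] : - X <= x <= X by rewrite -ler_norml.
have [Y0|Y0] := leP Y 0.
  have /andP[yY1 yY2] : Y <= y <= - Y by rewrite -[X in X <= y]opprK -ler_norml -(ler0_norm Y0).
  by apply: lerD; [apply: le_trans MX|apply: le_trans NY]; rewrite ler_expR; lra.
have /andP[yY1 yY2] : - Y <= y <= Y by rewrite -ler_norml -(gtr0_norm Y0).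
(* Both [X] and [Y] are now nonnegative. The larger one absorbs the increment of the other: [c - y]
   is reached from [c - Y] when [Y <= X], and [a + x] from [a - X] otherwise. *)
have [YX|XY] := leP Y X.
  have /andP[h1 h2] : - (X - Y) <= x - y <= X - Y.
    by rewrite -ler_norml -[leRHS]ger0_norm ?subr_ge0.
  have := @expR_gap_le (c - Y) (a + x) (Y - y) (X - x).
  rewrite (_ : c - Y + (Y - y) = c - y); last by ring.
  rewrite (_ : a + x + (X - x) = a + X); last by ring.
  have c1 : c - Y <= a + x by clear -ge1 yY1; lra.
  have c2 : 0 <= Y - y by clear -yY2; lra.
  have c3 : Y - y <= X - x by clear -h2; lra.
  move=> /(_ c1 c2 c3); clear -MX NY; lra.
have /andP[h1 h2] : - (Y - X) <= x - y <= Y - X.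
  by rewrite -ler_norml -[leRHS]gtr0_norm ?subr_gt0 // [leRHS]distrC.
have := @expR_gap_le (a - X) (c - y) (X + x) (Y + y).
rewrite (_ : a - X + (X + x) = a + x); last by ring.
rewrite (_ : c - y + (Y + y) = c + Y); last by ring.
have c1 : a - X <= c - y by clear -ge2 xX2; lra.
have c2 : 0 <= X + x by clear -xX1; lra.
have c3 : X + x <= Y + y by clear -h2; lra.
move=> /(_ c1 c2 c3); clear -MY NX; lra.
Qed.

(** The tangent line of [expR] at the mean [m] lies below the graph, and its linear part averages to
    zero. *)
Lemma expR_jensen (K : finType) (q x : K -> R) :
  (forall k, 0 <= q k) -> \sum_k q k = 1 ->
  expR (\sum_k q k * x k) <= \sum_k q k * expR (x k).
Proof.
move=> q0 q1; set m := \sum_k q k * x k.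
have -> : expR m = \sum_k q k * (expR m * (1 + (x k - m))).
  rewrite (eq_bigr (fun k => expR m * (1 - m) * q k + expR m * (q k * x k))); last by move=> k _; ring.
  by rewrite big_split -!big_distrr /= q1 -/m; ring.
apply: ler_sum => k _; apply: ler_wpM2l => //.
rewrite -[X in _ <= expR X](subrKC m) expRD ler_pM2l ?expR_gt0 //.
exact: expR_ge1Dx.
Qed.

(** Since [delta < 1 / 2], this lets a logarithm of [1 / delta] absorb additive constants. *)
Lemma ln_ge_half x : 2 <= x -> 1 / 2 <= ln x.
Proof.
move=> x2; have x0 : 0 < x by lra.
have e2 : expR (1 / 2) <= (2 : R).
  have h1 := @expR_ge1Dx R (- (1 / 2)).
  have h2 := expRxMexpNx_1 (1 / 2 : R); have h3 := expR_gt0 (1 / 2 : R); nra.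
by rewrite -[leLHS]expRK ler_ln ?posrE ?expR_gt0 // (le_trans e2).
Qed.

End ExpIneq.

(** * Exponential moments of finite empirical processes *)

Section MaxExp.
Variables (R : realType) (I : finType).
Implicit Types A : I -> R.

(** The default [0] lies below every exponential, so it is the value only when [I] is empty. *)
Definition maxexp A : R := \big[Num.max/0]_i expR (A i).

Lemma maxexp_ge A i : expR (A i) <= maxexp A.
Proof. exact: (le_bigmax_cond 0 (fun i => expR (A i))). Qed.

Lemma maxexp_le A c : 0 <= c -> (forall i, expR (A i) <= c) -> maxexp A <= c.
Proof. by move=> c0 H; apply: bigmax_le => // i _; exact: H. Qed.

Lemma maxexp_ge0 A : 0 <= maxexp A.
Proof. exact: bigmax_ge_id. Qed.

Lemma maxexp_eq A : maxexp A = 0 \/ exists i, maxexp A = expR (A i).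
Proof.
have [i0 _|H] := pickP I; last by left; apply: big_pred0 => i; have := H i.
right; eexists.
exact: (@bigmax_eq_arg _ R I 0 i0 xpredT (fun i => expR (A i)) isT (fun i _ => expR_ge0 _)).
Qed.

Lemma maxexp_contraction A (f g : I -> R) :
  (forall i j, `|f i - f j| <= `|g i - g j|) -> (forall i, `|f i| <= `|g i|) ->
  maxexp (fun i => A i + f i) + maxexp (fun i => A i - f i) <=
  maxexp (fun i => A i + g i) + maxexp (fun i => A i - g i).
Proof.
move=> fg2 fg1.
have [e|[i ->]] := maxexp_eq (fun i => A i + f i).
  rewrite e add0r; have [->|[j ->]] := maxexp_eq (fun i => A i - f i).
    by rewrite addr_ge0 ?maxexp_ge0.
  by have := expR_gt0 (A j + f j); rewrite ltNge -e maxexp_ge.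
have [e|[j ->]] := maxexp_eq (fun i => A i - f i).
  by have := expR_gt0 (A i - f i); rewrite ltNge -e (maxexp_ge (fun i => A i - f i)).
apply: (@expR_contraction _ (A i) (A j) (f i) (f j) (g i) (g j)).
- exact: fg2.
- exact: fg1.
- exact: fg1.
- exact: (maxexp_ge (fun i => A i + g i)).
- exact: (maxexp_ge (fun i => A i + g i)).
- exact: (maxexp_ge (fun i => A i - g i)).
- exact: (maxexp_ge (fun i => A i - g i)).
Qed.

End MaxExp.

Section Potential.
Variables (R : realType) (K I : finType) (q : K -> R) (f g : K -> I -> R).
Implicit Types A : I -> R.

(** Exponential moment of the supremum of a centred sum of [n] independent draws from [q]. The
    recursion takes one draw at a time, [A] accumulating the earlier ones, so that draws can be
    symmetrized singly; [centred_mgfE] unrolls it. *)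
Fixpoint centred_mgf n A : R := if n is n'.+1 then
    \sum_k q k * centred_mgf n' (fun i => A i + \sum_l q l * f l i - f k i)
  else maxexp A.

(** The same moment with each centred draw replaced by [g] times an independent fair sign, averaged
    explicitly. *)
Fixpoint rademacher_mgf n A : R := if n is n'.+1 then
    \sum_k q k * ((rademacher_mgf n' (fun i => A i + g k i)
                   + rademacher_mgf n' (fun i => A i - g k i)) / 2)
  else maxexp A.

Hypothesis q_ge0 : forall k, 0 <= q k.
Hypothesis q_sum1 : \sum_k q k = 1.
Hypothesis fg2 : forall k i j, `|2 * f k i - 2 * f k j| <= `|g k i - g k j|.
Hypothesis fg1 : forall k i, `|2 * f k i| <= `|g k i|.

(* Symmetrization (Jensen against an independent copy, then AM-GM) followed by
   contraction. *)
Lemma maxexp_symmetrization A :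
  \sum_k q k * maxexp (fun i => A i + \sum_l q l * f l i - f k i) <=
  \sum_k q k * ((maxexp (fun i => A i + g k i) + maxexp (fun i => A i - g k i)) / 2).
Proof.
(* The factor 2 comes from AM-GM: [A i + f l i - f k i] is the midpoint of [A i + 2 * f l i] and
   [A i - 2 * f k i]. *)
pose Pl k := maxexp (fun i => A i + 2 * f k i).
pose Mi k := maxexp (fun i => A i - 2 * f k i).
apply: (@le_trans _ _ (\sum_k q k * \sum_l q l * ((Pl l + Mi k) / 2))).
  apply: ler_sum => k _; apply: ler_wpM2l => //; apply: maxexp_le => [|i].
    by apply: sumr_ge0 => l _; rewrite mulr_ge0 // divr_ge0 // addr_ge0 ?maxexp_ge0.
  apply: (@le_trans _ _ (\sum_l q l * expR (A i + f l i - f k i))).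
    rewrite (_ : _ - _ = \sum_l q l * (A i + f l i - f k i)); first exact: expR_jensen.
    rewrite [RHS](eq_bigr (fun l => (A i - f k i) * q l + q l * f l i)); last by move=> l _; ring.
    by rewrite [RHS]big_split -big_distrr /= q_sum1; ring.
  apply: ler_sum => l _; apply: ler_wpM2l => //.
  apply: (@le_trans _ _ ((expR (A i + 2 * f l i) + expR (A i - 2 * f k i)) / 2)).
    by rewrite -[X in expR X](_ : (A i + 2 * f l i + (A i - 2 * f k i)) / 2 = _) ?expR_mid_le //; field.
  rewrite ler_pM2r ?invr_gt0 // lerD //.
    exact: (maxexp_ge (fun i => A i + 2 * f l i)).
  exact: (maxexp_ge (fun i => A i - 2 * f k i)).
rewrite (_ : \sum_k _ = \sum_k q k * ((Pl k + Mi k) / 2)).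
  apply: ler_sum => k _; apply: ler_wpM2l => //; rewrite ler_pM2r ?invr_gt0 //.
  exact: maxexp_contraction.
pose S := \sum_l q l * Pl l.
rewrite (eq_bigr (fun k => S / 2 * q k + q k * (Mi k / 2))).
  rewrite big_split -big_distrr /= q_sum1 mulr1 /S big_distrl -big_split /=.
  by apply: eq_bigr => k _; field.
move=> k _; rewrite (eq_bigr (fun l => q l * Pl l / 2 + Mi k / 2 * q l)); last by move=> l _; field.
by rewrite big_split -big_distrl -big_distrr /= q_sum1 -/S; field.
Qed.

(** A centred draw placed before [n] signed ones commutes with them, so it can be moved innermost,
    where [maxexp_symmetrization] applies. *)
Lemma rademacher_mgf_step n A :
  \sum_k q k * rademacher_mgf n (fun i => A i + \sum_l q l * f l i - f k i) <=
  \sum_k q k * ((rademacher_mgf n (fun i => A i + g k i)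
                 + rademacher_mgf n (fun i => A i - g k i)) / 2).
Proof.
elim: n A => [|n ih] A /=; first exact: maxexp_symmetrization.
under eq_bigr do rewrite big_distrr /=.
under [leRHS]eq_bigr do rewrite -big_split big_distrl big_distrr /=.
rewrite exchange_big [leRHS]exchange_big /=; apply: ler_sum => l _.
have := lerD (ih (fun i => A i + g l i)) (ih (fun i => A i - g l i)).
rewrite -!big_split /= => H.
have {H} := ler_wpM2l (q_ge0 l) H; rewrite !big_distrr /= => H.
have {H} : (_ <= _) := ler_wpM2r (_ : 0 <= 2^-1) H; rewrite invr_ge0 ler0n => /(_ isT).
rewrite !big_distrl /= => H; apply: (le_trans _ (le_trans H _)).
  rewrite le_eqVlt; apply/orP; left; apply/eqP; apply: eq_bigr => k _.
  rewrite (_ : (fun i => A i + \sum_l q l * f l i - f k i + g l i) =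
    fun i => A i + g l i + \sum_l q l * f l i - f k i); last by apply/funext => i; ring.
  rewrite (_ : (fun i => A i + \sum_l q l * f l i - f k i - g l i) =
    fun i => A i - g l i + \sum_l q l * f l i - f k i); last by apply/funext => i; ring.
  by field.
rewrite le_eqVlt; apply/orP; left; apply/eqP; apply: eq_bigr => k _.
rewrite (_ : (fun i => A i + g k i + g l i) = fun i => A i + g l i + g k i); last by apply/funext => i; ring.
rewrite (_ : (fun i => A i + g k i - g l i) = fun i => A i - g l i + g k i); last by apply/funext => i; ring.
rewrite (_ : (fun i => A i - g k i + g l i) = fun i => A i + g l i - g k i); last by apply/funext => i; ring.
rewrite (_ : (fun i => A i - g k i - g l i) = fun i => A i - g l i - g k i); last by apply/funext => i; ring.
by field.
Qed.

(** Hybrid argument: the inner draws are already symmetrized by induction, and the outermost one is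
    then exchanged by [rademacher_mgf_step]. *)
Lemma centred_mgf_le n A : centred_mgf n A <= rademacher_mgf n A.
Proof.
elim: n A => [|n ih] A //=.
apply: le_trans (rademacher_mgf_step n A).
by apply: ler_sum => k _; apply: ler_wpM2l.
Qed.

Lemma big_tuple_cons n (F : n.+1.-tuple K -> R) :
  \sum_(t : n.+1.-tuple K) F t = \sum_k \sum_(t : n.-tuple K) F [tuple of k :: t].
Proof.
rewrite pair_big /= (reindex (fun x : K * n.-tuple K => [tuple of x.1 :: x.2])) //=.
exists (fun t : n.+1.-tuple K => (thead t, [tuple of behead t])) => [[k t] _|t _] /=.
  by rewrite theadE; congr (_, _); apply/val_inj.
by rewrite [RHS]tuple_eta.
Qed.

Lemma centred_mgfE n A :
  centred_mgf n A = \sum_(t : n.-tuple K) (\prod_(j < n) q (tnth t j)) *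
    maxexp (fun i => A i + \sum_(j < n) (\sum_l q l * f l i - f (tnth t j) i)).
Proof.
elim: n A => [|n ih] A /=.
  rewrite (big_pred1 [tuple]) => [|t]; last by rewrite /= tuple0; apply/esym/eqP.
  rewrite big_ord0 mul1r; congr maxexp; apply/funext => i.
  by rewrite big_ord0 addr0.
rewrite big_tuple_cons; apply: eq_bigr => k _; rewrite ih big_distrr /=.
apply: eq_bigr => t _; rewrite big_ord_recl tnth0 mulrA; congr (_ * _ * _).
  by apply: eq_bigr => j _; rewrite tnthS.
congr maxexp; apply/funext => i; rewrite big_ord_recl tnth0 !addrA; congr (_ + _).
by apply: eq_bigr => j _; rewrite tnthS.
Qed.

End Potential.

(** * Dimension-free exponential moment of the norm of a Rademacher sum *)

Section RademacherBound.
Variables (R : realType) (d : nat) (K I : finType) (q : K -> R).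
Variables (v : K -> 'rV[R]_d) (h : I -> 'rV[R]_d) (r c : R).
Hypothesis q_ge0 : forall k, 0 <= q k.
Hypothesis q_sum1 : \sum_k q k = 1.
Hypothesis v_le1 : forall k, enorm (v k) <= 1.
Hypothesis h_ler : forall i, enorm (h i) <= r.
Hypothesis r_ge0 : 0 <= r.
Hypothesis c_ge0 : 0 <= c.

Lemma sqrt_sqrD_lipschitz (s t b : R) : 0 <= s -> 0 <= t -> 0 <= b ->
  `|Num.sqrt (s ^+ 2 + b) - Num.sqrt (t ^+ 2 + b)| <= `|s - t|.
Proof.
wlog st : s t / t <= s => [H|] s0 t0 b0.
  have [ts|/ltW st] := leP t s; first exact: H.
  by rewrite distrC [leRHS]distrC; exact: H.
have tb : t <= Num.sqrt (t ^+ 2 + b).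
  by rewrite -[leLHS](ger0_norm t0) -sqrtr_sqr ler_wsqrtr // lerDl.
have mono : Num.sqrt (t ^+ 2 + b) <= Num.sqrt (s ^+ 2 + b).
  by rewrite ler_wsqrtr // lerD2r ler_pXn2r.
rewrite !ger0_norm ?subr_ge0 // lerBlDr.
rewrite -(ler_pXn2r (n := 2)) ?nnegrE ?sqrtr_ge0 //; last by rewrite addr_ge0 ?sqrtr_ge0 ?subr_ge0.
rewrite sqr_sqrtr ?addr_ge0 ?sqr_ge0 // sqrrD sqr_sqrtr ?addr_ge0 ?sqr_ge0 //.
have st0 : 0 <= s - t by rewrite subr_ge0.
have := ler_wpM2l st0 tb; nra.
Qed.

Lemma sqrt_mid_le (s t : R) : 0 <= s -> 0 <= t ->
  (Num.sqrt s + Num.sqrt t) / 2 <= Num.sqrt ((s + t) / 2).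
Proof.
move=> s0 t0.
rewrite -(ler_pXn2r (n := 2)) ?nnegrE ?sqrtr_ge0 ?divr_ge0 ?addr_ge0 ?sqrtr_ge0 //.
rewrite sqr_sqrtr ?divr_ge0 ?addr_ge0 //.
have := sqr_ge0 (Num.sqrt s - Num.sqrt t).
by have := sqr_sqrtr s0; have := sqr_sqrtr t0; nra.
Qed.

(** One signed step for the potential [expR (r * sqrt (|u| ^ 2 + b))]. By concavity of the square
    root and the parallelogram law, the mean exponent grows only through [b + c ^ 2]. The
    half-difference of the exponents is at most [r * c], since the square root is 1-Lipschitz in the
    norm, and [expR_avg] combines the two. *)
Lemma expR_sqrt_step u (w : 'rV[R]_d) (b : R) : 0 <= b -> enorm w <= c ->
  (expR (r * Num.sqrt (enorm (u + w) ^+ 2 + b))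
   + expR (r * Num.sqrt (enorm (u - w) ^+ 2 + b))) / 2
  <= expR (r * Num.sqrt (enorm u ^+ 2 + (c ^+ 2 + b))) * expR ((r * c) ^+ 2).
Proof.
move=> b0 wc; apply: le_trans (expR_avg _ _) _.
apply: ler_pM; rewrite ?expR_ge0 // ler_expR.
  rewrite -mulrDr -mulrA ler_wpM2l //.
  apply: le_trans (sqrt_mid_le _ _) _; rewrite ?addr_ge0 ?sqr_ge0 //.
  rewrite ler_wsqrtr // !sqr_enormD enormN dotpNr.
  have : enorm w ^+ 2 <= c ^+ 2 by rewrite ler_pXn2r ?nnegrE ?enorm_ge0.
  lra.
rewrite -mulrBr -mulrA -[leLHS]real_normK ?num_real // ler_pXn2r ?nnegrE ?mulr_ge0 //.
rewrite normrM (ger0_norm r_ge0) ler_wpM2l // normrM [`|2^-1|]ger0_norm ?invr_ge0 // ler_pdivrMr //.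
apply: le_trans (sqrt_sqrD_lipschitz _ _ b0) _; rewrite ?enorm_ge0 //.
have e1 : enorm (u + w) <= enorm (u - w) + 2 * enorm w.
  rewrite (_ : u + w = (u - w) + (2 *: w)); last by rewrite scaler_nat mulr2n; rewrite addrA subrK.
  by rewrite (le_trans (ler_enormD _ _)) // enormZ ger0_norm.
have e2 : enorm (u - w) <= enorm (u + w) + 2 * enorm w.
  rewrite (_ : u - w = (u + w) - (2 *: w)); last by rewrite scaler_nat mulr2n opprD addrA addrK.
  by rewrite (le_trans (ler_enormD _ _)) // enormN enormZ ger0_norm.
by rewrite ler_norml; lra.
Qed.

(** For linear functionals the maximum is at most [expR (r * |u|)], which is the potential at
    [b = 0]. Each signed draw costs one use of [expR_sqrt_step], so only [n * c ^ 2] appears, and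
    neither [d] nor the size of [I]. *)
Lemma rademacher_mgf_linear n u :
  rademacher_mgf q (fun k i => c * dotp (h i) (v k)) n (fun i => dotp (h i) u)
  <= expR (r * Num.sqrt (enorm u ^+ 2 + n%:R * c ^+ 2)) * expR (n%:R * (r * c) ^+ 2).
Proof.
elim: n u => [|n ih] u /=.
  rewrite !mul0r expR0 mulr1 addr0 sqrtr_sqr ger0_norm ?enorm_ge0 //.
  apply: maxexp_le => [|i]; first exact: expR_ge0.
  by rewrite ler_expR (le_trans (dotp_le_enorm _ _)) // ler_wpM2r ?enorm_ge0.
set B := leRHS; have -> : B = \sum_k q k * B by rewrite -big_distrl /= q_sum1 mul1r.
rewrite /B; apply: ler_sum => k _; apply: ler_wpM2l => //.
have e1 : (fun i => dotp (h i) u + c * dotp (h i) (v k)) = fun i => dotp (h i) (u + c *: v k).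
  by apply/funext => i; rewrite dotpDr dotpZr.
have e2 : (fun i => dotp (h i) u - c * dotp (h i) (v k)) = fun i => dotp (h i) (u - c *: v k).
  by apply/funext => i; rewrite dotpBr dotpZr.
rewrite e1 e2.
have H := lerD (ih (u + c *: v k)) (ih (u - c *: v k)).
rewrite -mulrDl in H.
have i2 : 0 <= 2^-1 :> R by rewrite invr_ge0.
apply: le_trans (ler_wpM2r i2 H) _; rewrite mulrAC.
have nc : 0 <= n%:R * c ^+ 2 by rewrite mulr_ge0 // sqr_ge0.
have wc : enorm (c *: v k) <= c by rewrite enormZ ger0_norm // ler_piMr.
apply: le_trans (ler_wpM2r (expR_ge0 _) (expR_sqrt_step u nc wc)) _.
rewrite -mulrA -(expRD ((r * c) ^+ 2)) le_eqVlt; apply/orP; left; apply/eqP.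
have -> : c ^+ 2 + n%:R * c ^+ 2 = n.+1%:R * c ^+ 2 by rewrite -natr1; ring.
by have -> : (r * c) ^+ 2 + n%:R * (r * c) ^+ 2 = n.+1%:R * (r * c) ^+ 2 by rewrite -natr1; ring.
Qed.

End RademacherBound.

Section FiniteDeviation.
Variables (R : realType) (d : nat) (K I : finType) (q : K -> R).
Variables (v : K -> 'rV[R]_d) (h : I -> 'rV[R]_d) (l : K -> I -> R) (r : R).

Lemma finite_deviation n (tau delta : R) :
  (forall k, 0 <= q k) -> \sum_k q k = 1 ->
  (forall k, enorm (v k) <= 1) -> (forall i, enorm (h i) <= r) -> 0 < r ->
  (forall k i j, `|l k i - l k j| <= `|dotp (h i) (v k) - dotp (h j) (v k)|) ->
  (forall k i, `|l k i| <= `|dotp (h i) (v k)|) ->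
  0 < tau -> 0 < delta < 1 / 2 -> 96 * r ^+ 2 * ln (1 / delta) <= n%:R * tau ^+ 2 ->
  \sum_(t : n.-tuple K |
     [exists i, n%:R * tau <= \sum_(j < n) (\sum_k q k * l k i - l (tnth t j) i)])
    \prod_(j < n) q (tnth t j) <= delta.
Proof.
move=> q0 q1 v1 hr r0 l2 l1 tau0 /andP[d0 dh] nbig.
(* This value minimizes the Chernoff exponent [- lam * tau + 8 * r ^ 2 * lam ^ 2] per sample. *)
pose lam := tau / (16 * r ^+ 2).
have r2 : 0 < r ^+ 2 by rewrite exprn_gt0.
have lam0 : 0 < lam by rewrite divr_gt0 // mulr_gt0.
pose f k i := lam * l k i.
have mgf : centred_mgf q f n (fun=> 0) <= expR (1 + 2 * n%:R * (r * (2 * lam)) ^+ 2).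
  apply: le_trans (@centred_mgf_le _ _ _ q f (fun k i => 2 * lam * dotp (h i) (v k)) q0 q1 _ _ n _) _.
  - move=> k i j; rewrite /f !(mulrA 2) -!mulrBr !normrM ler_wpM2l //.
  - by move=> k i; rewrite /f !(mulrA 2) !normrM ler_wpM2l.
  have -> : (fun=> 0) = (fun i => dotp (h i) 0) by apply/funext => i; rewrite dotp0r.
  have c0 : 0 <= 2 * lam by rewrite mulr_ge0 // ltW.
  apply: le_trans (rademacher_mgf_linear q0 q1 v1 hr (ltW r0) c0 n 0) _.
  rewrite enorm0 expr0n add0r -expRD ler_expR.
  set X := r * Num.sqrt _.
  have X2 : X ^+ 2 = n%:R * (r * (2 * lam)) ^+ 2.
    by rewrite /X exprMn sqr_sqrtr ?(mulr_ge0 (ler0n _ _) (sqr_ge0 _)) //; ring.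
  clearbody X; have := sqr_ge0 (X - 1); nra.
(* Chernoff bound: on a bad tuple the exponential weight times the maximum is at least 1. *)
apply: (@le_trans _ _ (expR (- (lam * (n%:R * tau))) * centred_mgf q f n (fun=> 0))).
  rewrite centred_mgfE big_distrr big_mkcond /=; apply: ler_sum => t _.
  have p0 : 0 <= \prod_(j < n) q (tnth t j) by exact: prodr_ge0.
  case: ifPn => [/existsP[i Hi]|_]; last first.
    by rewrite mulr_ge0 ?expR_ge0 // mulr_ge0 // maxexp_ge0.
  rewrite mulrCA ler_peMr //.
  apply: le_trans (ler_wpM2l (expR_ge0 _) (maxexp_ge _ i)).
  rewrite -expRD -[leLHS]expR0 ler_expR add0r.
  have := ler_wpM2l (ltW lam0) Hi.
  rewrite [X in _ <= X -> _](_ : _ = \sum_(j < n) (\sum_k q k * f k i - f (tnth t j) i)); first by lra.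
  rewrite big_distrr /=; apply: eq_bigr => j _.
  rewrite mulrBr big_distrr /=; congr (_ - _); apply: eq_bigr => k _; rewrite /f; ring.
apply: le_trans (ler_wpM2l (expR_ge0 _) mgf) _.
rewrite -expRD -[leRHS]lnK ?posrE // ler_expR.
have ld : ln (1 / delta) = - ln delta by rewrite div1r lnV ?posrE.
(* The exponent is [1 - n * tau ^ 2 / (32 * r ^ 2)]. The constant [96 = 3 * 32] makes it at most
   [1 - 3 * ln (1 / delta)], and two of the three logarithms pay for the 1. *)
have ln2 : 1 / 2 <= ln (1 / delta).
  by apply: ln_ge_half; rewrite ler_pdivlMr //; lra.
rewrite (_ : - _ + _ = 1 - n%:R * tau ^+ 2 / (32 * r ^+ 2)); last first.
  by rewrite /lam; field; rewrite gt_eqF.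
have : 96 * r ^+ 2 * ln (1 / delta) / (32 * r ^+ 2) <= n%:R * tau ^+ 2 / (32 * r ^+ 2).
  by rewrite ler_pM2r // invr_gt0 mulr_gt0.
rewrite (_ : 96 * r ^+ 2 * _ / _ = 3 * ln (1 / delta)); last by field; rewrite gt_eqF.
lra.
Qed.

End FiniteDeviation.

(** * Discretization of the mean loss *)

Definition measurable_coord (R : realType) d0 (T : measurableType d0) (d : nat) (X : T -> 'rV[R]_d) :=
  forall i, measurable_fun setT (fun w => X w ord0 i).

Section Measurability.
Variables (R : realType) (d0 : measure_display) (T : measurableType d0) (d : nat).
Implicit Types X Y : T -> 'rV[R]_d.

Lemma measurable_coordP X : measurable_fun setT (@rv2t R d \o X) <-> measurable_coord X.
Proof.
split=> [/measurable_fun_tnthP H i|H]; last apply/measurable_fun_tnthP => i.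
  by apply: eq_measurable_fun (H i) => w _; rewrite /= tnth_mktuple.
by apply: eq_measurable_fun (H i) => w _; rewrite /= tnth_mktuple.
Qed.

Lemma measurable_coordD X Y : measurable_coord X -> measurable_coord Y -> measurable_coord (fun w => X w + Y w).
Proof.
move=> mX mY i.
apply: (eq_measurable_fun (fun w => X w ord0 i + Y w ord0 i)); last exact: measurable_funD.
by move=> w _; rewrite mxE.
Qed.

Lemma measurable_dotp X Y : measurable_coord X -> measurable_coord Y ->
  measurable_fun setT (fun w => dotp (X w) (Y w)).
Proof. by move=> mX mY; apply: measurable_sum => i; exact: measurable_funM. Qed.

Lemma measurable_enorm X : measurable_coord X -> measurable_fun setT (fun w => enorm (X w)).
Proof.
move=> mX; apply: (measurableT_comp (f := @Num.sqrt R)); last exact: measurable_dotp.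
apply: continuous_measurable_fun; exact: sqrt_continuous.
Qed.

Lemma measurable_le_real (f : T -> R) (a : R) : measurable_fun setT f ->
  measurable [set w | f w <= a].
Proof.
move=> mf; have := mf measurableT `]-oo, a]%classic (measurable_itv _).
by rewrite setTI (_ : _ @^-1` _ = [set w | f w <= a]) //; apply/seteqP; split => w /=; rewrite in_itv.
Qed.

Lemma measurable_lt_real (f : T -> R) (a : R) : measurable_fun setT f ->
  measurable [set w | a < f w].
Proof.
move=> mf; rewrite (_ : mkset _ = ~` [set w | f w <= a]); first exact/measurableC/measurable_le_real.
by apply/seteqP; split => w /=; [rewrite ltNge => /negP|move/negP; rewrite -ltNge].
Qed.

End Measurability.

Lemma measure_bigsetU_le (R : realType) d0 (T : measurableType d0)
  (mu : probability T R) (I : Type) (s : seq I) (P : pred I) (F : I -> set T) (a : I -> R) :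
  (forall i, P i -> measurable (F i)) -> (forall i, P i -> (mu (F i) <= (a i)%:E)%E) ->
  (mu (\big[setU/set0]_(i <- s | P i) F i) <= (\sum_(i <- s | P i) a i)%:E)%E.
Proof.
move=> mF Fa; elim: s => [|i s ih]; first by rewrite !big_nil measure0.
rewrite !big_cons; case: ifPn => // Pi; rewrite EFinD.
apply: le_trans (measureU2 _ (mF _ Pi) _) _; first exact: bigsetU_measurable.
by apply: leeD => //; exact: Fa.
Qed.

Section FiniteNet.
Variables (R : realType) (d : nat).

(** A cell records which thresholds of a fine grid lie below each coordinate. Two points of the ball
    with the same record differ by at most one mesh in every coordinate, and such cells are
    measurable by construction. *)
Lemma finite_net (rad eps : R) : 0 <= rad -> 0 < eps ->
  exists (K : finType) (cell : 'rV[R]_d -> K) (rep : K -> 'rV[R]_d),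
    [/\ forall k, enorm (rep k) <= rad,
        forall u, enorm u <= rad -> enorm (u - rep (cell u)) <= eps &
        forall d0 (T : measurableType d0) (X : T -> 'rV[R]_d), measurable_coord X ->
          forall k, measurable [set w | cell (X w) = k]].
Proof.
move=> rad0 eps0.
(* The mesh is [1 / s]; [d.+1] keeps [s] positive when [d = 0], and [d / s <= eps]. The two extra
   thresholds in [m] leave room for the index just above any coordinate of the ball. *)
pose s : R := d.+1%:R / eps.
have s0 : 0 < s by rewrite divr_gt0.
pose m := (Num.truncn (2 * rad * s)).+2.
pose thr (j : 'I_m) : R := - rad + j%:R / s.
pose cell (u : 'rV[R]_d) : {ffun 'I_d * 'I_m -> bool} := [ffun ij => thr ij.2 <= u ord0 ij.1].
pose in_cell k u := enorm u <= rad /\ cell u = k.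
(* The representative is some point of the cell inside the ball; cells that miss the ball get
   [0]. *)
pose rep k := if pselect (exists u, in_cell k u) is left e then projT1 (cid e) else 0.
have half u u' i : enorm u <= rad -> enorm u' <= rad -> cell u = cell u' ->
    u' ord0 i - u ord0 i <= 1 / s.
  move=> hu hu' e; rewrite leNgt; apply/negP => lt1.
  have /ler_normlP[u1 u2] := le_trans (enorm_coord u i) hu.
  have /ler_normlP[u1' u2'] := le_trans (enorm_coord u' i) hu'.
  pose x := (u ord0 i + rad) * s.
  have x0 : 0 <= x by rewrite mulr_ge0 ?(ltW s0) //; lra.
  have /andP[t1 t2] := truncn_itv x0.
  have jm : ((Num.truncn x).+1 < m)%N.
    rewrite ltnS ltnS; apply: le_truncn.
    by rewrite ler_wpM2r ?(ltW s0) //; lra.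
  have /ffunP/(_ (i, Ordinal jm)) := e; rewrite !ffunE /thr /=.
  have -> : (- rad + (Num.truncn x).+1%:R / s <= u ord0 i) = false.
    apply/negbTE; rewrite -ltNge.
    have : x / s < (Num.truncn x).+1%:R / s by rewrite ltr_pM2r ?invr_gt0.
    by rewrite /x mulfK ?gt_eqF //; lra.
  suff -> : - rad + (Num.truncn x).+1%:R / s <= u' ord0 i by [].
  have : (Num.truncn x)%:R / s <= x / s by rewrite ler_pM2r ?invr_gt0.
  rewrite /x mulfK ?gt_eqF // -/x -natr1 mulrDl; lra.
exists {ffun 'I_d * 'I_m -> bool}, cell, rep; split.
- move=> k; rewrite /rep; case: pselect => [e|_]; last by rewrite enorm0.
  by case: (cid e) => u [].
- move=> u hu; rewrite /rep; case: pselect => [e|]; last by case; exists u.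
  case: (cid e) => u' [hu' eu'] /=.
  apply: le_trans (enorm_le_coord (a := 1 / s) _) _.
    move=> i; rewrite !mxE ler_norml; have := half u u' i hu hu' (esym eu').
    have := half u' u i hu' hu eu'; lra.
  rewrite /s div1r invf_div mulrCA ler_piMr ?(ltW eps0) // ler_pdivrMr // mul1r ler_nat //.
- move=> d0 T X mX k.
  rewrite (_ : mkset _ = \bigcap_(ij in [set: 'I_d * 'I_m])
      [set w | (thr ij.2 <= X w ord0 ij.1) = k ij]).
    apply: fin_bigcap_measurable => // -[i j] _ /=.
    have mX' := mX i; case: (k (i, j)).
      rewrite (_ : mkset _ = ~` [set w | X w ord0 i < thr j]).
        apply: measurableC; rewrite (_ : mkset _ = [set w | - thr j < - X w ord0 i]).
          by apply: measurable_lt_real; exact: measurable_funN.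
        by apply/seteqP; split => w /=; rewrite ltrN2.
      by apply/seteqP; split => w /=; [move=> h /lt_geF; rewrite h|move=> /negP; rewrite -leNgt].
    rewrite (_ : mkset _ = [set w | - thr j < - X w ord0 i]).
      by apply: measurable_lt_real; exact: measurable_funN.
    by apply/seteqP; split => w /=; rewrite ltrN2 leNgt; [move/negbFE|move->].
  apply/seteqP; split => w /= => [<- ij _|H]; first by rewrite ffunE.
  by apply/ffunP => ij; rewrite ffunE; exact: H.
Qed.

End FiniteNet.

Section MeanLoss.
Import numFieldNormedType.Exports.
Variables (R : realType) (d0 : measure_display) (T : measurableType d0).
Variables (mu : probability T R) (d : nat) (V : T -> 'rV[R]_d) (L : R -> R).
Hypothesis mV : measurable_coord V.
Let D := [set z | enorm (V z) <= 1].
Hypothesis muD : mu D = 1%E.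
Hypothesis L_lip : forall a b, `|L a - L b| <= `|a - b|.

(** The integral is taken over [D], where the loss is bounded and hence integrable; [integral_loss]
    recovers the full expectation because [D] has full measure. *)
Definition mean_loss (f : 'rV[R]_d) : R := \int[mu]_(z in D) L (dotp f (V z)).

Let mD : measurable D.
Proof. exact/measurable_le_real/measurable_enorm. Qed.

Lemma measurable_lipschitz : measurable_fun setT L.
Proof.
apply: continuous_measurable_fun => x; apply/cvgrPdist_le => /= e e0.
near=> y; apply: le_trans (L_lip x y) _; near: y.
exact: cvgr_dist_le.
Unshelve. all: by end_near. Qed.

Lemma measurable_loss f : measurable_fun setT (fun z => L (dotp f (V z))).
Proof.
by apply: (measurableT_comp measurable_lipschitz); apply: measurable_dotp => // i.
Qed.

Let bounded_integrable (g : T -> R) (M : R) : measurable_fun setT g ->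
  (forall z, D z -> `|g z| <= M) -> mu.-integrable D (EFin \o g).
Proof.
move=> mg gM; apply: measurable_bounded_integrable => //.
- by rewrite (le_lt_trans (probability_le1 _ mD)) // ltry.
- exact: measurable_funTS.
- exists M; split; first exact: num_real.
  by move=> M' MM' z Dz /=; exact: le_trans (gM z Dz) (ltW MM').
Qed.

Lemma loss_le (f g : 'rV[R]_d) : `|L (dotp f g)| <= `|L 0| + enorm f * enorm g.
Proof.
rewrite -[X in `|X|](subrK (L 0)) addrC (le_trans (ler_normD _ _)) // lerD2l.
by rewrite (le_trans (L_lip _ _)) // subr0 cauchy_schwarz.
Qed.

Lemma integrable_loss f : mu.-integrable D (EFin \o (fun z => L (dotp f (V z)))).
Proof.
apply: (@bounded_integrable _ (`|L 0| + enorm f)); first exact: measurable_loss.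
move=> z Dz; apply: le_trans (loss_le _ _) _.
by rewrite lerD2l ler_piMr ?enorm_ge0.
Qed.

Lemma integral_loss f :
  (\int[mu]_z (L (dotp f (V z)))%:E)%E = (mean_loss f)%:E.
Proof.
have muDC : mu (~` D) = 0 by rewrite probability_setC // muD subee.
have mDC : measurable (~` D) := measurableC mD.
have DE : D = setT `\` ~` D by rewrite setTD setCK.
rewrite (negligible_integral mDC measurableT _ muDC) /=.
  rewrite -DE /mean_loss /Rintegral fineK //.
  exact: (integrable_fin_num mD (integrable_loss f)).
apply/(negligible_integrable mDC measurableT _ muDC).
  exact/measurable_EFinP/measurable_loss.
by rewrite -DE; exact: integrable_loss.
Qed.

Lemma Rintegral_cst_D (a : R) : \int[mu]_(z in D) a = a.
Proof. by rewrite Rintegral_cst // [X in _ * fine X](_ : _ = 1%E) ?mulr1. Qed.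

Section Discretization.
Variables (K : finType) (cell : 'rV[R]_d -> K) (rep : K -> 'rV[R]_d) (eps : R).
Hypothesis rep_le1 : forall k, enorm (rep k) <= 1.
Hypothesis rep_near : forall u, enorm u <= 1 -> enorm (u - rep (cell u)) <= eps.
Hypothesis mcell : forall k, measurable [set z | cell (V z) = k].

Definition cell_weight k : R := fine (mu [set z | cell (V z) = k]).

Lemma cell_weightE k : mu [set z | cell (V z) = k] = (cell_weight k)%:E.
Proof. by rewrite /cell_weight fineK // fin_num_measure. Qed.

Lemma cell_weight_ge0 k : 0 <= cell_weight k.
Proof. exact: fine_ge0. Qed.

Let mu_cell_D k : mu ([set z | cell (V z) = k] `&` D) = (cell_weight k)%:E.
Proof.
rewrite -cell_weightE; set A := mkset _; have mA : measurable A := mcell k.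
have muDC : mu (~` D) = 0 by rewrite probability_setC // muD subee.
rewrite -[in RHS](setUIDK A D) [RHS]measureU //; last 3 first.
- exact: measurableI.
- exact: measurableD.
- by rewrite setDE setIACA setICr setI0.
rewrite [X in (_ + X)%E](_ : _ = 0%E) ?adde0 //.
apply/eqP; rewrite eq_le measure_ge0 andbT -muDC le_measure ?inE //.
- exact: measurableD.
- exact: measurableC.
Qed.

Lemma Rintegral_cell (c : K -> R) :
  \int[mu]_(z in D) c (cell (V z)) = \sum_k cell_weight k * c k.
Proof.
rewrite /Rintegral (eq_integral (fun z => \sum_k (c k * \1_[set z | cell (V z) = k] z)%:E)%E).
  rewrite integral_sum // => [|k]; last first.
    apply: (@bounded_integrable (fun z => c k * \1_[set z | cell (V z) = k] z) `|c k|).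
      by apply: measurable_funM => //; exact: measurable_indic.
    by move=> z _; rewrite normrM ler_piMr // indicE; case: (_ \in _); rewrite ?normr1 ?normr0.
  rewrite (eq_bigr (fun k => (cell_weight k * c k)%:E)); last first.
    move=> k _; under eq_integral do rewrite EFinM.
    rewrite integralZl //; last first.
      by apply: (@integrableS _ _ _ _ setT) => //; exact: integrable_indic.
    by rewrite integral_indic // [X in (_ * X)%E](mu_cell_D k) -EFinM mulrC.
  by rewrite sumEFin.
move=> z _; rewrite sumEFin; congr EFin.
rewrite (bigD1 (cell (V z))) //= big1 => [|k kz]; first by rewrite indicE mem_set //= mulr1 addr0.
by rewrite indicE memNset ?mulr0 //=; apply/eqP; rewrite eq_sym.
Qed.

Lemma cell_weight_sum : \sum_k cell_weight k = 1.
Proof.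
have := Rintegral_cell (fun=> 1); rewrite Rintegral_cst_D => ->.
by apply: eq_bigr => k _; rewrite mulr1.
Qed.

(** Moving a feature to its representative changes the argument of the 1-Lipschitz loss by at most
    [eps * enorm f]; the integral of the resulting simple function is the finite sum. *)
Lemma mean_loss_approx f :
  `|mean_loss f - \sum_k cell_weight k * L (dotp f (rep k))| <= eps * enorm f.
Proof.
rewrite -(Rintegral_cell (fun k => L (dotp f (rep k)))) /mean_loss.
have mg : measurable_fun setT (fun z => L (dotp f (rep (cell (V z))))).
  apply: (eq_measurable_fun (fun z => \sum_k L (dotp f (rep k)) * \1_[set z | cell (V z) = k] z)).
    move=> z _; rewrite (bigD1 (cell (V z))) //= big1 => [|k kz]; first by rewrite indicE mem_set //= mulr1 addr0.
    by rewrite indicE memNset ?mulr0 //=; apply/eqP; rewrite eq_sym.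
  by apply: measurable_sum => k; apply: measurable_funM => //; exact: measurable_indic.
have ig : mu.-integrable D (EFin \o (fun z => L (dotp f (rep (cell (V z)))))).
  apply: (@bounded_integrable _ (`|L 0| + enorm f)) => // z Dz.
  by apply: le_trans (loss_le _ _) _; rewrite lerD2l ler_piMr ?enorm_ge0.
have If := integrable_loss f.
have bnd z : D z -> `|L (dotp f (V z)) - L (dotp f (rep (cell (V z))))| <= eps * enorm f.
  move=> Dz; apply: le_trans (L_lip _ _) _.
  rewrite -dotpBr (le_trans (cauchy_schwarz _ _)) // mulrC ler_wpM2r ?enorm_ge0 //.
  exact: rep_near.
rewrite -RintegralB //.
have iB : mu.-integrable D (EFin \o (fun z => L (dotp f (V z)) - L (dotp f (rep (cell (V z)))))).
  by apply: (@bounded_integrable _ (eps * enorm f)) => //; apply: measurable_funB => //; exact: measurable_loss.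
apply: le_trans (le_normr_Rintegral mD iB) _.
have -> : eps * enorm f = \int[mu]_(z in D) (eps * enorm f).
  by rewrite Rintegral_cst_D.
apply: le_Rintegral => //.
  apply: (@bounded_integrable _ (eps * enorm f)); last by move=> z Dz; rewrite normr_id; exact: bnd.
  by apply: measurableT_comp => //; apply: measurable_funB => //; exact: measurable_loss.
by apply: (@bounded_integrable (fun=> eps * enorm f) `|eps * enorm f|).
Qed.

End Discretization.

(* Every inequality between finite convex combinations of losses passes to
   [mean_loss] through these discretizations. *)
Lemma mean_loss_discretize (eps : R) : 0 < eps ->
  exists (K : finType) (q : K -> R) (v : K -> 'rV[R]_d),
    [/\ forall k, 0 <= q k, \sum_k q k = 1, forall k, enorm (v k) <= 1 &
        forall f, `|mean_loss f - \sum_k q k * L (dotp f (v k))| <= eps * enorm f].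
Proof.
move=> eps0; have [K [cell [rep [r1 near mc]]]] := @finite_net R d 1 eps ler01 eps0.
exists K, (cell_weight cell), rep; split => //.
- exact: cell_weight_ge0.
- by apply: cell_weight_sum => // k; exact: mc.
- by move=> f; apply: mean_loss_approx => // k; exact: mc.
Qed.

End MeanLoss.

(** * Properties of the mean loss and uniform deviation *)

Section SmoothLoss.
Variables (R : realType) (L : R -> R).
Import numFieldNormedType.Exports.
Hypothesis L_der : forall a : R, derivable L a 1.

Lemma loss_mean_value (a b : R) : a <= b ->
  exists2 c, a <= c <= b & L b - L a = derive1 L c * (b - a).
Proof.
move=> ab; have der x : is_derive x (1 : R) L (derive1 L x).
  by rewrite derive1E; exact: derivableP.
have cL : {within `[a, b], continuous L}.
  by apply: derivable_within_continuous => x _; exact: L_der.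
have [c cab e] := @MVT_segment R L (derive1 L) a b ab (fun x _ => der x) cL.
by exists c => //; move: cab; rewrite in_itv.
Qed.

Lemma loss_lipschitz : (forall a, `|derive1 L a| <= 1) ->
  forall a b, `|L a - L b| <= `|a - b|.
Proof.
move=> d1 a b; wlog ab : a b / a <= b => [H|].
  have [ab|/ltW ba] := leP a b; first exact: H.
  by rewrite distrC [leRHS]distrC; exact: H.
have [c _ e] := loss_mean_value ab.
by rewrite distrC e normrM distrC ler_piMl.
Qed.

(** The second difference is a difference of two mean-value slopes taken at points at most [2 * x]
    apart. The absolute value appears because no sign is assumed for [c4]. *)
Lemma loss_second_difference (c4 : R) :
  (forall a b, `|derive1 L a - derive1 L b| <= c4 * `|a - b|) ->
  forall a x, L (a + x) + L (a - x) - 2 * L a <= 2 * `|c4| * x ^+ 2.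
Proof.
move=> d2 a x; wlog x0 : x / 0 <= x => [H|].
  have [x0|/ltW x0] := leP 0 x; first exact: H.
  by have := H (- x); rewrite oppr_ge0 opprK sqrrN [L (a - x) + _]addrC; exact.
have [c1 /andP[h1 h2] e1] := @loss_mean_value a (a + x) ltac:(lra).
have [c2 /andP[h3 h4] e2] := @loss_mean_value (a - x) a ltac:(lra).
have d12 : derive1 L c1 - derive1 L c2 <= 2 * `|c4| * x.
  apply: le_trans (ler_norm _) _; apply: le_trans (d2 _ _) _.
  apply: (@le_trans _ _ (`|c4| * `|c1 - c2|)); first by rewrite ler_wpM2r // ler_norm.
  rewrite [2 * _]mulrC -mulrA ler_wpM2l // ger0_norm; lra.
have := ler_wpM2r x0 d12.
have -> : L (a + x) + L (a - x) - 2 * L a = (L (a + x) - L a) - (L a - L (a - x)) by ring.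
rewrite e1 e2; lra.
Qed.

End SmoothLoss.

Section MeanLossProperties.
Import numFieldNormedType.Exports.
Variables (R : realType) (d0 : measure_display) (T : measurableType d0).
Variables (mu : probability T R) (d : nat) (V : T -> 'rV[R]_d) (L : R -> R).
Hypothesis mV : measurable_coord V.
Hypothesis muD : mu [set z | enorm (V z) <= 1] = 1%E.
Hypothesis L_lip : forall a b, `|L a - L b| <= `|a - b|.
Let C := mean_loss mu V L.

(** Transfer principle: a linear inequality between losses, valid at each feature of the unit ball,
    survives averaging. The list holds coefficients and predictors; the discretization error is
    proportional to [A] and is made smaller than any [e]. *)
Lemma mean_loss_comb (s : seq (R * 'rV[R]_d)) (c : R) :
  (forall v : 'rV[R]_d, enorm v <= 1 -> \sum_(x <- s) x.1 * L (dotp x.2 v) <= c) ->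
  \sum_(x <- s) x.1 * C x.2 <= c.
Proof.
move=> H; apply/ler_addgt0Pr => e e0.
pose A := \sum_(x <- s) `|x.1| * enorm x.2.
have A0 : 0 <= A by apply: sumr_ge0 => x _; rewrite mulr_ge0 ?enorm_ge0.
have A1 : 0 < A + 1 by lra.
have [K [q [v [q0 q1 v1 app]]]] := mean_loss_discretize mV muD L_lip (divr_gt0 e0 A1).
have h1 : \sum_(x <- s) x.1 * C x.2 <=
    \sum_(x <- s) (x.1 * \sum_k q k * L (dotp x.2 (v k)) + e / (A + 1) * (`|x.1| * enorm x.2)).
  apply: ler_sum => x _; rewrite -lerBlDl -mulrBr mulrCA.
  apply: le_trans (ler_norm _) _; rewrite normrM ler_wpM2l //; exact: app.
apply: le_trans h1 _; rewrite big_split -big_distrr /= -/A; apply: lerD.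
  under eq_bigr do rewrite big_distrr /=.
  rewrite exchange_big /= -[leRHS]mul1r -q1 big_distrl /=; apply: ler_sum => k _.
  under eq_bigr do rewrite mulrCA.
  by rewrite -big_distrr ler_wpM2l //; exact: H.
by rewrite mulrAC ler_pdivrMr // ler_wpM2l ?(ltW e0) //; lra.
Qed.

Lemma mean_loss_lipschitz f g : C f - C g <= enorm (f - g).
Proof.
have := @mean_loss_comb [:: (1, f); (-1, g)] (enorm (f - g)).
rewrite !big_cons big_nil /= !mul1r !mulN1r addr0; apply => v v1.
rewrite !big_cons big_nil /= !mul1r !mulN1r addr0.
apply: le_trans (ler_norm _) _; apply: le_trans (L_lip _ _) _.
by rewrite -dotpBl (le_trans (cauchy_schwarz _ _)) // ler_piMr // enorm_ge0.
Qed.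

Lemma mean_loss_midpoint f g :
  (forall a b t : R, 0 <= t <= 1 -> L (t * a + (1 - t) * b) <= t * L a + (1 - t) * L b) ->
  C (2^-1 *: (f + g)) <= (C f + C g) / 2.
Proof.
move=> cvx.
have := @mean_loss_comb [:: (1, 2^-1 *: (f + g)); (-2^-1, f); (-2^-1, g)] 0.
rewrite !big_cons big_nil /= !mul1r addr0 => H.
suff : C (2^-1 *: (f + g)) + (- 2^-1 * C f + - 2^-1 * C g) <= 0 by lra.
apply: H => v v1; rewrite !big_cons big_nil /= dotpZl dotpDl.
have := cvx (dotp f v) (dotp g v) 2^-1.
rewrite (_ : 2^-1 * _ + _ = 2^-1 * (dotp f v + dotp g v)); last by field.
move=> h; have := h ltac:(lra); lra.
Qed.

Lemma mean_loss_second_difference (c4 : R) f x :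
  (forall a b, L (a + b) + L (a - b) - 2 * L a <= 2 * `|c4| * b ^+ 2) ->
  C (f + x) + C (f - x) - 2 * C f <= 2 * `|c4| * enorm x ^+ 2.
Proof.
move=> smooth.
have := @mean_loss_comb [:: (1, f + x); (1, f - x); (-2, f)] (2 * `|c4| * enorm x ^+ 2).
rewrite !big_cons big_nil /= !mul1r addr0 => H.
suff : C (f + x) + (C (f - x) + - 2 * C f) <= 2 * `|c4| * enorm x ^+ 2 by lra.
apply: H => v v1; rewrite !big_cons big_nil /= !mul1r addr0 dotpDl dotpBl.
have h1 := smooth (dotp f v) (dotp x v).
have h2 : `|dotp x v| <= enorm x.
  by rewrite (le_trans (cauchy_schwarz _ _)) // ler_piMr // enorm_ge0.
have h3 : dotp x v ^+ 2 <= enorm x ^+ 2.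
  by rewrite -[leLHS]real_normK ?num_real // ler_pXn2r ?nnegrE ?enorm_ge0.
have := ler_wpM2l (_ : 0 <= 2 * `|c4|) h3; rewrite mulr_ge0 // => /(_ isT); lra.
Qed.

Lemma mean_loss_lower f : L 0 - enorm f <= C f.
Proof.
have := @mean_loss_comb [:: (-1, f)] (enorm f - L 0).
rewrite !big_cons big_nil /= addr0 => H.
suff : - 1 * C f <= enorm f - L 0 by lra.
apply: H => v v1; rewrite !big_cons big_nil /= addr0.
have := L_lip 0 (dotp f v); rewrite sub0r normrN => h.
have h2 : `|dotp f v| <= enorm f.
  by rewrite (le_trans (cauchy_schwarz _ _)) // ler_piMr // enorm_ge0.
have := le_trans (le_trans (ler_norm _) h) h2; lra.
Qed.

(** The mean loss is the pointwise limit of its discretizations of mesh [1 / (n + 1)], which are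
    finite sums of measurable functions. *)
Lemma measurable_mean_loss d1 (W : measurableType d1) (X : W -> 'rV[R]_d) :
  measurable_coord X -> measurable_fun setT (fun w => C (X w)).
Proof.
move=> mX.
have /choice[h hP] : forall n, exists h : 'rV[R]_d -> R,
    measurable_fun setT (fun w => h (X w)) /\
    forall f, `|C f - h f| <= n.+1%:R^-1 * enorm f.
  move=> n; have e0 : (0 : R) < n.+1%:R^-1 by rewrite invr_gt0.
  have [K [q [v [_ _ _ app]]]] := mean_loss_discretize mV muD L_lip e0.
  exists (fun f => \sum_k q k * L (dotp f (v k))); split => //.
  apply: measurable_sum => k; apply: measurable_funM => //.
  by apply: (measurableT_comp (measurable_lipschitz L_lip)); apply: measurable_dotp => // i.
apply: (@measurable_fun_cvg _ _ _ _ (fun n w => h n (X w))) => [n|w _].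
  by have [] := hP n.
have lim0 : (fun n => n.+1%:R^-1 * enorm (X w)) @ \oo --> (0 : R).
  rewrite -[X in _ --> X](mul0r (enorm (X w))).
  by apply: cvgM; [exact: cvg_harmonic|exact: cvg_cst].
apply/cvgrPdist_le => /= e e0; near=> n.
apply: le_trans ((hP n).2 _) _; near: n.
move/cvgrPdist_le : lim0 => /(_ _ e0); apply: filterS => n.
by apply: le_trans; rewrite sub0r normrN ler_norm.
Unshelve. all: by end_near. Qed.

End MeanLossProperties.

Section UniformDeviation.
Variables (R : realType) (d0 : measure_display) (T : measurableType d0).
Variables (mu : probability T R) (d : nat) (V : T -> 'rV[R]_d) (L : R -> R).
Variables (d1 : measure_display) (Omega : measurableType d1) (P : probability Omega R).
Variables (n : nat) (Z : 'I_n -> Omega -> T).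
Hypothesis mV : measurable_coord V.
Hypothesis muD : mu [set z | enorm (V z) <= 1] = 1%E.
Hypothesis L_lip : forall a b, `|L a - L b| <= `|a - b|.
Hypothesis mZ : forall j, measurable_fun setT (Z j).
Hypothesis Z_law : forall j A, measurable A -> P (Z j @^-1` A) = mu A.
Hypothesis Z_indep : mutually_indep P Z.
Let C := mean_loss mu V L.
Let D := [set z | enorm (V z) <= 1].

Let mD : measurable D.
Proof. exact/measurable_le_real/measurable_enorm. Qed.

Let mZpre j A : measurable A -> measurable (Z j @^-1` A).
Proof. by move=> mA; rewrite -[X in measurable X]setTI; exact: mZ. Qed.

Lemma cells_law (K : finType) (c : T -> K) (t : n.-tuple K) :
  (forall k, measurable [set z | c z = k]) ->
  P (\big[setI/setT]_(j < n) (Z j @^-1` [set z | c z = tnth t j])) =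
  (\prod_(j < n) fine (mu [set z | c z = tnth t j]))%:E.
Proof.
move=> mc; have := Z_indep [set: 'I_n]%SET (fun j => mc (tnth t j)).
rewrite (eq_bigl xpredT) => [->|j]; last by rewrite inE.
rewrite (eq_bigl xpredT) => [|j]; last by rewrite inE.
rewrite -prodEFin; apply: eq_bigr => j _.
by rewrite Z_law // fineK // fin_num_measure.
Qed.

(* The union bound is over cells and over a finite net, but the tail estimate
   [finite_deviation] depends on neither cardinality, so the meshes may be
   taken as fine as needed. *)
Lemma uniform_deviation (p : 'rV[R]_d) (r tau delta : R) :
  0 < r -> 0 < tau -> 0 < delta < 1 / 2 ->
  384 * r ^+ 2 * ln (1 / delta) <= n%:R * tau ^+ 2 ->
  exists2 Bad : set Omega, measurable Bad /\ (P Bad <= delta%:E)%E &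
  forall w, ~ Bad w -> forall h : 'rV[R]_d, enorm h <= r ->
    n%:R * (C (p + h) - C p) <=
    \sum_(j < n) (L (dotp (p + h) (V (Z j w))) - L (dotp p (V (Z j w)))) + n%:R * tau.
Proof.
move=> r0 tau0 dd big.
(* Half of [tau] goes to [finite_deviation], whence [384 = 4 * 96]. The other half pays for
   discretizing the mean and the sample, each costing [eps * (1 + 2 * enorm p + r)] per sample, and
   [M] dominates twice that factor. *)
pose M := 6 * enorm p + 6 * r + 2.
have M0 : 0 < M by rewrite /M; have := enorm_ge0 p; lra.
pose eps := tau / 2 / M.
have eps0 : 0 < eps by rewrite !divr_gt0.
have [K [cell [rep [rep1 rep_near mcell]]]] := @finite_net R d 1 eps ler01 eps0.
have [I [net [hh [hh_r hh_near _]]]] := @finite_net R d r eps (ltW r0) eps0.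
have mc k : measurable [set z | cell (V z) = k] := mcell _ _ _ mV k.
pose q := cell_weight mu V cell.
have q0 k : 0 <= q k := cell_weight_ge0 _ _ _ _.
have q1 : \sum_k q k = 1 by apply: cell_weight_sum.
pose l k i := L (dotp (p + hh i) (rep k)) - L (dotp p (rep k)).
pose S (t : n.-tuple K) := [exists i, n%:R * (tau / 2) <=
  \sum_(j < n) (\sum_k q k * l k i - l (tnth t j) i)].
have fin : \sum_(t | S t) \prod_(j < n) q (tnth t j) <= delta.
  apply: (@finite_deviation R d K I q rep hh l r) => //.
  - move=> k i j; rewrite /l opprB addrA subrK (le_trans (L_lip _ _)) // !dotpDl.
    by rewrite opprD addrACA subrr add0r.
  - by move=> k i; rewrite /l (le_trans (L_lip _ _)) // dotpDl addrAC subrr add0r.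
  - by rewrite divr_gt0.
  - by lra.
pose F t := \big[setI/setT]_(j < n) (Z j @^-1` [set z | cell (V z) = tnth t j]).
have mF t : measurable (F t) by apply: bigsetI_measurable => j _; exact: mZpre.
pose B1 := \big[setU/set0]_(t | S t) F t.
(* The null event that some sample leaves the unit ball, where [rep_near] would give nothing. *)
pose B2 := \big[setU/set0]_(j < n) (Z j @^-1` (~` D)).
have mB1 : measurable B1 by apply: bigsetU_measurable => t _.
have mB2 : measurable B2.
  by apply: bigsetU_measurable => j _; apply: mZpre; exact: measurableC.
have PB1 : (P B1 <= delta%:E)%E.
  apply: (@le_trans _ _ (\sum_(t | S t) \prod_(j < n) q (tnth t j))%:E); last by rewrite lee_fin.
  by apply: measure_bigsetU_le => // t _; rewrite /F (cells_law _ mc).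
have PB2 : (P B2 <= 0)%E.
  rewrite -[leRHS](_ : (\sum_(j < n) (0 : R))%:E = _); last by rewrite big1.
  apply: measure_bigsetU_le => j _; first by apply: mZpre; exact: measurableC.
  rewrite Z_law; last exact: measurableC.
  by rewrite probability_setC // [X in (_ - X)%E](_ : _ = 1%E) ?subee.
exists (B1 `|` B2).
  split; first exact: measurableU.
  by apply: le_trans (measureU2 _ mB1 mB2) _; rewrite -[leRHS]adde0 leeD.
move=> w nBad h hr.
pose i := net h; pose t := [tuple cell (V (Z j w)) | j < n].
have VD j : enorm (V (Z j w)) <= 1.
  apply: contrapT => nD; apply: nBad; right; rewrite /B2 -bigcup_seq.
  by exists j => //=; rewrite mem_index_enum.
have nS : ~~ S t.
  apply/negP => St; apply: nBad; left; rewrite /B1 -bigcup_seq_cond.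
  exists t; first by rewrite /= mem_index_enum St.
  by rewrite /F -bigcap_seq => j _ /=; rewrite tnth_mktuple.
have {nS} : \sum_(j < n) (\sum_k q k * l k i - l (tnth t j) i) < n%:R * (tau / 2).
  by rewrite ltNge; apply/negP => le1; move/negP: nS; apply; apply/existsP; exists i.
rewrite sumrB sumr_const card_ord -[_ *+ n]mulr_natl => dev.
have hi : enorm (h - hh i) <= eps := hh_near _ hr.
have ph : enorm (p + h) <= enorm p + r by rewrite (le_trans (ler_enormD _ _)) // lerD2l.
have phi : enorm (p + hh i) <= enorm p + r by rewrite (le_trans (ler_enormD _ _)) // lerD2l.
have lip1 (f u u' : 'rV[R]_d) : `|L (dotp f u) - L (dotp f u')| <= enorm f * enorm (u - u').
  by rewrite (le_trans (L_lip _ _)) // -dotpBr cauchy_schwarz.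
have diffs : (p + h) - (p + hh i) = h - hh i by rewrite opprD addrACA subrr add0r.
have mean : C (p + h) - C p <= \sum_k q k * l k i + eps * (1 + 2 * enorm p + r).
  have a1 := mean_loss_approx mV muD L_lip rep1 rep_near mc (p + hh i).
  have a2 := mean_loss_approx mV muD L_lip rep1 rep_near mc p.
  have a3 := mean_loss_lipschitz mV muD L_lip (p + h) (p + hh i).
  rewrite diffs in a3.
  have -> : \sum_k q k * l k i = \sum_k q k * L (dotp (p + hh i) (rep k)) - \sum_k q k * L (dotp p (rep k)).
    by rewrite -sumrB; apply: eq_bigr => k _; rewrite mulrBr.
  move: a1 a2 => /ler_normlP[_ a1] /ler_normlP[a2 _].
  have a4 := ler_wpM2l (ltW eps0) phi.
  rewrite -/C -/q in a1 a2 a3 *; lra.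
have samples : \sum_(j < n) l (tnth t j) i <=
    \sum_(j < n) (L (dotp (p + h) (V (Z j w))) - L (dotp p (V (Z j w)))) +
    n%:R * (eps * (1 + 2 * enorm p + r)).
  rewrite -[X in X%:R * _]card_ord mulr_natl -sumr_const -big_split /=.
  apply: ler_sum => j _; rewrite tnth_mktuple /l.
  have near := rep_near _ (VD j).
  have /ler_normlP[b1 _] := lip1 (p + hh i) (V (Z j w)) (rep (cell (V (Z j w)))).
  have /ler_normlP[_ b2] := lip1 p (V (Z j w)) (rep (cell (V (Z j w)))).
  have b3 : L (dotp (p + hh i) (V (Z j w))) - L (dotp (p + h) (V (Z j w))) <= eps.
    apply: le_trans (ler_norm _) _; apply: le_trans (L_lip _ _) _.
    rewrite distrC -dotpBl diffs (le_trans (cauchy_schwarz _ _)) // (le_trans _ hi) //.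
    by rewrite ler_piMr // enorm_ge0.
  have b4 : enorm (p + hh i) * enorm (V (Z j w) - rep (cell (V (Z j w)))) <= (enorm p + r) * eps.
    by apply: ler_pM; rewrite ?enorm_ge0.
  have b5 : enorm p * enorm (V (Z j w) - rep (cell (V (Z j w)))) <= enorm p * eps.
    by rewrite ler_wpM2l ?enorm_ge0.
  lra.
have epsM : eps * M = tau / 2 by rewrite /eps mulfVK // gt_eqF.
have small : eps * (1 + 2 * enorm p + r) + eps * (1 + 2 * enorm p + r) <= tau / 2.
  rewrite -epsM -mulrDr ler_wpM2l ?(ltW eps0) // /M; have := enorm_ge0 p; lra.
have n0 : (0 : R) <= n%:R by [].
have s1 := ler_wpM2l n0 mean; have s2 := ler_wpM2l n0 small.
lra.
Qed.

End UniformDeviation.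

(** * Tails of the noise *)

Section LebesgueScaling.
Variables (R : realType) (s : R).
Hypothesis s_gt0 : 0 < s.
Let mu := @lebesgue_measure R.
Let scale (t : measurableTypeR R) : measurableTypeR R := s * t.

Let mscale_fun : measurable_fun setT scale.
Proof. exact: measurable_funM. Qed.

HB.instance Definition _ := isMeasurableFun.Build _ _ _ _ scale mscale_fun.

(** Lebesgue measure equals [s] times its pushforward under scaling because the two agree on
    half-open intervals. *)
Lemma lebesgue_integral_scale (g : R -> \bar R) :
  measurable_fun setT g -> (forall t, 0 <= g t)%E ->
  (\int[mu]_t g t = s%:E * \int[mu]_t g (s * t)%R)%E.
Proof.
move=> mg g0.
have s0 := ltW s_gt0.
have eqmu A : measurable A -> mu A = mscale (NngNum s0) (pushforward mu scale) A.
  move=> mA; apply: lebesgue_measure_unique => // _ [[a b]] _ <-.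
  have pre : scale @^-1` `]a, b]%classic = `]a / s, b / s]%classic.
    by apply/seteqP; split => t /=; rewrite !in_itv /= ltr_pdivrMr // ler_pdivlMr // /scale (mulrC s).
  transitivity (s%:E * mu `](a / s)%R, (b / s)%R]%classic)%E; last by rewrite -pre.
  rewrite /mu !lebesgue_measure_itv /= !lte_fin ltr_pM2r ?invr_gt0 //.
  case: ifPn => _; last by rewrite mule0.
  by rewrite -EFinD -EFinM -mulrBl mulrC divfK ?gt_eqF.
rewrite (@eq_measure_integral _ _ _ _ (mscale (NngNum s0) (pushforward mu scale))); last first.
  by move=> A mA _; exact: eqmu.
rewrite ge0_integral_mscale //; congr (_ * _)%E.
by rewrite ge0_integral_pushforward.
Qed.

End LebesgueScaling.

Section IteratedIntegral.
Variable R : realType.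
Local Notation iint := (iter_lebesgue_integral (R := R)).
Local Notation RT := (measurableTypeR R).

Lemma iter_lebesgue_integral_ge0 n (g : n.-tuple R -> \bar R) :
  (forall v, 0 <= g v)%E -> (0 <= iint g)%E.
Proof.
elim: n g => [|n ih] g g0 //=.
by apply: integral_ge0 => t _; exact: ih.
Qed.

(** The parameter space [S] is arbitrary so that the induction can move the first coordinate into it
    and apply Tonelli measurability to the outer integral. *)
Lemma measurable_iter_lebesgue_integral n d0 (S : measurableType d0)
  (g : S -> n.-tuple RT -> \bar R) :
  measurable_fun setT (fun x : S * n.-tuple RT => g x.1 x.2) ->
  (forall s v, 0 <= g s v)%E -> measurable_fun setT (fun s => iint (g s)).
Proof.
elim: n d0 S g => [|n ih] d0 S g mg g0 /=.
  apply: (measurableT_comp mg (f := fun x : S * 0.-tuple RT => g x.1 x.2) (g := fun s => (s, [tuple]))).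
  exact: measurable_fun_pair.
pose g' (x : S * RT) (v : n.-tuple RT) := g x.1 [tuple of x.2 :: v].
have mg' : measurable_fun setT (fun x : S * RT * n.-tuple RT => g' x.1 x.2).
  apply: (measurableT_comp mg (f := fun x : S * n.+1.-tuple RT => g x.1 x.2)
    (g := fun x : S * RT * n.-tuple RT => (x.1.1, [tuple of x.1.2 :: x.2]))).
  apply: measurable_fun_pair; first exact: (measurableT_comp measurable_fst measurable_fst).
  apply: measurable_cons; first exact: (measurableT_comp measurable_snd measurable_fst).
  exact: measurable_snd.
have := @measurable_fun_fubini_tonelli_F _ _ S RT R (@lebesgue_measure R)
  (fun x => iint (g' x)) (ih _ _ g' mg' (fun x v => g0 _ _)).
apply => x; apply: iter_lebesgue_integral_ge0 => v; exact: g0.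
Qed.

Section Slices.
Variables (n : nat) (g : n.+1.-tuple RT -> \bar R).
Hypotheses (mg : measurable_fun setT g) (g0 : forall v, (0 <= g v)%E).

Lemma measurable_slice_cons (t : RT) :
  measurable_fun setT (fun v : n.-tuple RT => g [tuple of t :: v]).
Proof.
apply: (measurableT_comp mg (g := fun v : n.-tuple RT => [tuple of t :: v])).
by apply: measurable_cons.
Qed.

Lemma measurable_slice_integral :
  measurable_fun setT (fun t : RT => iint (fun v => g [tuple of t :: v])).
Proof.
apply: measurable_iter_lebesgue_integral => [|t v]; last exact: g0.
apply: (measurableT_comp mg (g := fun x : RT * n.-tuple RT => [tuple of x.1 :: x.2])).
by apply: measurable_cons.
Qed.

End Slices.

Lemma le_iter_lebesgue_integral n (g h : n.-tuple RT -> \bar R) :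
  measurable_fun setT g -> measurable_fun setT h ->
  (forall v, 0 <= g v)%E -> (forall v, g v <= h v)%E -> (iint g <= iint h)%E.
Proof.
elim: n g h => [|n ih] g h mg mh g0 gh //=.
have h0 v : (0 <= h v)%E by exact: le_trans (g0 v) (gh v).
apply: ge0_le_integral => //.
- by move=> t _; apply: iter_lebesgue_integral_ge0 => v; exact: g0.
- exact: measurable_slice_integral.
- exact: measurable_slice_integral.
- move=> t _; apply: ih => // ; exact: measurable_slice_cons.
Qed.

Lemma iter_lebesgue_integralZl n (k : R) (g : n.-tuple RT -> \bar R) : 0 <= k ->
  measurable_fun setT g -> (forall v, 0 <= g v)%E ->
  (iint (fun v => k%:E * g v) = k%:E * iint g)%E.
Proof.
move=> k0; elim: n g => [|n ih] g mg g0 //=.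
rewrite -ge0_integralZl //.
- apply: eq_integral => t _; apply: ih => // ; exact: measurable_slice_cons.
- exact: measurable_slice_integral.
- by move=> t _; apply: iter_lebesgue_integral_ge0 => v; exact: g0.
Qed.

Lemma iter_lebesgue_integral_scale n (s : R) (g : n.-tuple RT -> \bar R) : 0 < s ->
  measurable_fun setT g -> (forall v, 0 <= g v)%E ->
  (iint g = (s ^+ n)%:E * iint (fun v => g [tuple (s * tnth v i)%R | i < n]))%E.
Proof.
move=> s0; elim: n g => [|n ih] g mg g0 /=.
  by rewrite expr0 mul1e; congr g; apply/eq_from_tnth => - [].
have s0' : 0 <= s ^+ n by rewrite exprn_ge0 // ltW.
pose sc m (v : m.-tuple RT) : m.-tuple RT := [tuple (s * tnth v i)%R | i < m].
have msc m : measurable_fun setT (sc m).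
  apply/measurable_fun_tnthP => i.
  apply: (eq_measurable_fun (fun v => s * tnth v i)); first by move=> v _; rewrite /= tnth_mktuple.
  by apply: measurable_funM => //; exact: measurable_tnth.
have gsc : measurable_fun setT (g \o sc n.+1) := measurableT_comp mg (msc n.+1).
rewrite (lebesgue_integral_scale s0); last 2 first.
- exact: measurable_slice_integral.
- by move=> t; apply: iter_lebesgue_integral_ge0 => v; exact: g0.
rewrite exprS EFinM -muleA; congr (_ * _)%E.
rewrite -ge0_integralZl //; last 2 first.
- exact: (measurable_slice_integral gsc (fun v => g0 _)).
- by move=> t _; apply: iter_lebesgue_integral_ge0 => v; exact: g0.
apply: eq_integral => t _; rewrite ih //; last exact: measurable_slice_cons.
congr (_ * iint _)%E; apply/funext => v; congr g; apply/eq_from_tnth => i.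
rewrite tnth_mktuple; case: (unliftP ord0 i) => [j|] ->.
  by rewrite !tnthS tnth_mktuple.
by rewrite !tnth0.
Qed.

End IteratedIntegral.

Section NoiseTail.
Variables (R : realType) (d : nat).
Local Notation RT := (measurableTypeR R).

Lemma measurable_coord_t2rv : measurable_coord (fun v : d.-tuple RT => t2rv v).
Proof.
move=> i; apply: (eq_measurable_fun (fun v : d.-tuple RT => tnth v i)); last exact: measurable_tnth.
by move=> v _; rewrite /t2rv mxE.
Qed.

Lemma rv2tK : cancel (@rv2t R d) (@t2rv R d).
Proof. by move=> u; apply/rowP => i; rewrite mxE tnth_mktuple. Qed.

(** On the event [t < |v|], [expR (- zeta |v|)] is at most [expR (- zeta t / 2)] times the density
    at half the rate, whose total mass is [2 ^ d] by scaling. *)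
Lemma noise_tail d0 (T : measurableType d0) (P : probability T R) (X : T -> 'rV[R]_d)
  (zeta t : R) : 0 < zeta ->
  has_density_prop_to P X (fun v => expR (- (zeta * enorm v))) ->
  (P [set w | (t < enorm (X w))%R] <= (2 ^+ d * expR (- (zeta * t / 2)))%:E)%E.
Proof.
move=> z0 [c dens].
pose en (v : d.-tuple RT) := enorm (t2rv v).
have men : measurable_fun setT en by apply: measurable_enorm; exact: measurable_coord_t2rv.
pose g (a : R) (v : d.-tuple RT) : \bar R := (expR (- (a * en v)))%:E.
have mexp a : measurable_fun setT (fun v => expR (- (a * en v))).
  apply: (measurableT_comp (@measurable_expR R)).
  by apply: measurable_funN; exact: measurable_funM.
have mg a : measurable_fun setT (g a) by exact/measurable_EFinP.
have g0 a v : (0 <= g a v)%E by rewrite lee_fin expR_ge0.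
set I := @iter_lebesgue_integral R d.
have total : (c%:E * I (g zeta) = 1)%E.
  have := dens setT measurableT; rewrite preimage_setT probability_setT => ->.
  by congr (_ * I _)%E; apply/funext => v; rewrite indicT mul1r.
have I0 a : (0 <= I (g a))%E by exact: iter_lebesgue_integral_ge0.
(* The normalizing constant comes without a sign; a total mass of 1 against a nonnegative integral
   forces it. *)
have c0 : 0 <= c.
  rewrite leNgt; apply/negP => cn.
  have : (c%:E * I (g zeta) <= 0)%E by apply: mule_le0_ge0 => //; rewrite lee_fin ltW.
  by rewrite total lee_fin ler10.
have half : (c%:E * I (g (zeta / 2)%R) = (2 ^+ d)%:E)%E.
  have sc : I (g zeta) = ((2^-1 ^+ d)%:E * I (g (zeta / 2)%R))%E.
    rewrite {1}/I (@iter_lebesgue_integral_scale R d 2^-1) ?invr_gt0 //; congr (_ * I _)%E.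
    apply/funext => v; rewrite /g /en; congr (expR (- _))%:E.
    rewrite (_ : t2rv [tuple _ | i < d] = 2^-1 *: t2rv v).
      by rewrite enormZ ger0_norm ?invr_ge0 // mulrA.
    by apply/rowP => i; rewrite !mxE tnth_mktuple.
  have := total; rewrite sc muleCA => e.
  rewrite -[LHS]mul1e -[1%E](_ : ((2 ^+ d)%:E * (2^-1 ^+ d)%:E)%E = _).
    by rewrite -muleA e mule1.
  by rewrite -EFinM -exprMn divff ?expr1n // pnatr_eq0.
pose A := [set v | t < en v].
have mA : measurable A by exact: measurable_lt_real.
have -> : [set w | t < enorm (X w)] = (@rv2t R d \o X) @^-1` A.
  by apply/seteqP; split => w /=; rewrite /A /en /= rv2tK.
rewrite (dens _ mA).
apply: (@le_trans _ _ (c%:E * I (fun v => (expR (- (zeta * t / 2)))%:E * g (zeta / 2)%R v))%E).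
  rewrite lee_wpmul2l ?lee_fin //; apply: le_iter_lebesgue_integral.
  - apply/measurable_EFinP; apply: measurable_funM; first exact: measurable_indic.
    exact: (mexp zeta).
  - by apply: measurable_funeM; exact: mg.
  - by move=> v; rewrite lee_fin mulr_ge0 ?expR_ge0.
  - move=> v; rewrite /g -EFinM lee_fin -expRD.
    have [/set_mem Av|Av] := boolP (v \in A).
      rewrite indicE mem_set // mul1r ler_expR; rewrite /A /= in Av.
      have := ler_wpM2l (ltW z0) (ltW Av); rewrite -/(en v); lra.
    by rewrite indicE (negbTE Av) mul0r expR_ge0.
by rewrite /I (@iter_lebesgue_integralZl R d _ (g (zeta / 2)) (expR_ge0 _) (mg _) (g0 _)) -/I muleCA half -EFinM lee_fin mulrC.
Qed.

(** The parameter [m] prepares a union bound over [m + 1] noises: the tail is at most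
    [2 ^ d * delta ^ ((m + 2) * d)], hence at most [delta / 2 ^ m], and [m + 1 <= 2 ^ m]. *)
Lemma noise_tail_log d0 (T : measurableType d0) (P : probability T R) (X : T -> 'rV[R]_d)
  (zeta delta : R) (m : nat) : 0 < zeta -> (0 < d)%N -> 0 < delta < 1 / 2 ->
  has_density_prop_to P X (fun v => expR (- (zeta * enorm v))) ->
  (P [set w | (2 * m.+2%:R * d%:R * ln (d%:R / delta) / zeta < enorm (X w))%R]
    <= (delta / m.+1%:R)%:E)%E.
Proof.
move=> z0 d_gt0 /andP[de0 deh] dens.
apply: le_trans (noise_tail _ z0 dens) _; rewrite lee_fin.
have dR : (1 : R) <= d%:R by rewrite ler1n.
rewrite (_ : - _ = (m.+2 * d)%N%:R * (- ln (d%:R / delta))); last first.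
  by rewrite natrM; field; rewrite gt_eqF.
have d_pos : (0 : R) < d%:R by exact: lt_le_trans dR.
have ld : expR (- ln (d%:R / delta)) <= delta.
  have dd : 0 < d%:R / delta by rewrite divr_gt0.
  rewrite expRN lnK ?posrE // invf_div ler_pdivrMr //.
  by rewrite ler_peMr // ltW.
rewrite expRM_natl.
apply: (@le_trans _ _ (2 ^+ d * delta ^+ (m.+2 * d))).
  rewrite ler_wpM2l ?exprn_ge0 //.
  by apply: lerXn2r; rewrite ?nnegrE ?expR_ge0 ?(ltW de0).
(* One power of [delta] is kept, [m + d] powers are bounded by [1 / 2] to cancel [2 ^ d] and leave
   [2 ^ - m], and the rest are at most 1. *)
have kd : (m.+2 * d = (m + d + (m.+1 * d.-1)).+1)%N by case: d d_gt0 => // k _ /=; lia.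
apply: (@le_trans _ _ (2 ^+ d * (delta * (1 / 2) ^+ (m + d)))).
  rewrite ler_wpM2l ?exprn_ge0 // kd exprS ler_wpM2l ?(ltW de0) //.
  rewrite exprD; apply: (@le_trans _ _ (delta ^+ (m + d))).
    by rewrite ler_piMr ?exprn_ge0 ?(ltW de0) // exprn_ile1 ?(ltW de0) //; lra.
  by apply: lerXn2r; rewrite ?nnegrE ?(ltW de0) ?(ltW deh) // divr_ge0.
rewrite mulrCA ler_wpM2l ?(ltW de0) // addnC exprD mulrA -exprMn.
rewrite (_ : 2 * (1 / 2) = 1); last by field.
rewrite expr1n mul1r div1r exprVn lef_pV2 ?posrE ?exprn_gt0 // -natrX ler_nat.
exact: ltn_expl.
Qed.

End NoiseTail.

(** * Perturbed ridge minimization *)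

Section RegularizedRisk.
Variables (R : realType) (d : nat) (A : 'rV[R]_d -> R) (rho : R).
Hypothesis rho_gt0 : 0 < rho.

Definition ridge (f : 'rV[R]_d) : R := A f + rho * (enorm f ^+ 2 / 2).

(** Completing the square bounds the objective below, so its infimum is approached within [gamma];
    no compactness or attainment enters. *)
Lemma ridge_near_min (a b gamma : R) : (forall f, a - b * enorm f <= A f) -> 0 < gamma ->
  exists p, forall f, ridge p <= ridge f + gamma.
Proof.
move=> low g0; pose E := range ridge.
have lbE : lbound E (a - b ^+ 2 / (2 * rho)).
  move=> _ [f _ <-]; apply: le_trans (_ : a - b * enorm f + rho * (enorm f ^+ 2 / 2) <= _); last first.
    by rewrite lerD2r.
  rewrite -subr_ge0 (_ : _ - _ = (rho * enorm f - b) ^+ 2 / (2 * rho)).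
    by rewrite divr_ge0 ?sqr_ge0 // mulr_ge0 // ltW.
  by field; rewrite gt_eqF.
have hE : has_inf E by split; [exists (ridge 0), 0|exists (a - b ^+ 2 / (2 * rho))].
have [_ [p _ <-] ple] := inf_adherent g0 hE.
exists p => f; apply: (le_trans (ltW ple)); rewrite lerD2r.
by apply: ge_inf; [case: hE|exists f].
Qed.

(** Near-minimality is tested at the midpoint of [p] and [g], where the parallelogram law gains a
    multiple of the squared distance; doubling the inequality doubles [gamma]. *)
Lemma ridge_growth p g (gamma : R) :
  A (2^-1 *: (p + g)) <= (A p + A g) / 2 -> (forall f, ridge p <= ridge f + gamma) ->
  rho / 4 * enorm (g - p) ^+ 2 - 2 * gamma <= ridge g - ridge p.
Proof.
move=> mid /(_ (2^-1 *: (p + g))); rewrite /ridge.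
have -> : enorm (2^-1 *: (p + g)) ^+ 2 =
    (enorm p ^+ 2 + enorm g ^+ 2) / 2 - enorm (g - p) ^+ 2 / 4.
  rewrite enormZ exprMn !sqr_enormD enormN dotpNr real_normK ?num_real // (dotpC g p); by field.
set x := enorm p ^+ 2; set y := enorm g ^+ 2; set z := enorm (g - p) ^+ 2.
by move=> h; lra.
Qed.

End RegularizedRisk.

Section PerturbedMinimizer.
Variables (R : realType) (d : nat) (A E : 'rV[R]_d -> R) (rho eta : R).
Hypothesis rho_gt0 : 0 < rho.
Hypothesis eta_ge0 : 0 <= eta.
Hypothesis A_mid : forall f g, A (2^-1 *: (f + g)) <= (A f + A g) / 2.
Hypothesis E_cvx : forall f g t, 0 <= t <= 1 ->
  E (t *: f + (1 - t) *: g) <= t * E f + (1 - t) * E g.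

Lemma ridge_cvx f g t : 0 <= t <= 1 ->
  ridge E rho (t *: f + (1 - t) *: g) <= t * ridge E rho f + (1 - t) * ridge E rho g.
Proof.
move=> t01; have := E_cvx f g t01; rewrite /ridge.
rewrite sqr_enormD !enormZ !exprMn !real_normK ?num_real // dotpZl dotpZr.
have := sqr_ge0 (enorm (f - g)); rewrite sqr_enormD enormN dotpNr.
case/andP: t01 => t0 t1.
set x := enorm f ^+ 2; set y := enorm g ^+ 2; set z := dotp f g => h1 h2.
have t2 : 0 <= rho / 2 * (t * (1 - t)).
  by rewrite mulr_ge0 ?divr_ge0 ?(ltW rho_gt0) // mulr_ge0 // subr_ge0.
have := ler_wpM2l t2 h1; rewrite mulr0; lra.
Qed.

(* If the minimizer left the ball of radius [r], convexity would make the
   empirical objective at most [eta * enorm W * r] above its centre somewhere on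
   the sphere, against the quadratic growth of the population objective. *)
Lemma perturbed_minimizer_excess (p fs W : 'rV[R]_d) (r tau gamma : R) :
  0 < r ->
  (forall f, ridge A rho p <= ridge A rho f + gamma) ->
  (forall h, enorm h <= r -> A (p + h) - A p <= E (p + h) - E p + tau) ->
  (forall g, ridge E rho fs - eta * dotp fs W <= ridge E rho g - eta * dotp g W) ->
  eta * enorm W * r + tau + 2 * gamma < rho / 4 * r ^+ 2 ->
  ridge A rho fs - ridge A rho p <= eta * enorm W * r + tau.
Proof.
move=> r0 near dev fs_min small.
have devr h : enorm h <= r ->
    ridge A rho (p + h) - ridge A rho p <= ridge E rho (p + h) - ridge E rho p + tau.
  by move=> hr; have := dev h hr; rewrite /ridge; lra.
pose h := fs - p.
have fsE : fs = p + h by rewrite /h addrC subrK.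
have gap : ridge E rho fs - ridge E rho p <= eta * enorm W * enorm h.
  have := fs_min p; rewrite {2}fsE dotpDl.
  have := ler_wpM2l eta_ge0 (dotp_le_enorm h W); lra.
have [hr|hr] := leP (enorm h) r.
  have := devr h hr; rewrite -fsE.
  have : eta * enorm W * enorm h <= eta * enorm W * r.
    by rewrite ler_wpM2l // mulr_ge0 ?enorm_ge0.
  lra.
exfalso.
have h0 : 0 < enorm h by exact: lt_trans hr.
pose s := r / enorm h.
have s01 : 0 <= s <= 1 by rewrite divr_ge0 ?(ltW r0) ?(ltW h0) //= ler_pdivrMr // mul1r ltW.
have nsh : enorm (s *: h) = r by rewrite enormZ ger0_norm ?divfK ?gt_eqF //; case/andP: s01.
have seg : s *: fs + (1 - s) *: p = p + s *: h.
  by rewrite fsE scalerDr scalerBl scale1r addrC addrA subrK.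
have := ridge_cvx fs p s01; rewrite seg => c1.
have c2 := devr (s *: h); rewrite nsh in c2; have {}c2 := c2 (lexx r).
have := ridge_growth (A_mid p (p + s *: h)) near.
rewrite addrAC subrr add0r nsh => c3.
have c4 : s * (ridge E rho fs - ridge E rho p) <= eta * enorm W * r.
  apply: (@le_trans _ _ (s * (eta * enorm W * enorm h))); first by rewrite ler_wpM2l //; case/andP: s01.
  by rewrite mulrCA /s divfK ?gt_eqF.
lra.
Qed.

(* [A (fs + x)] is compared with [A (fs - x)] by smoothness, so that only the
   second-order effect of the output noise [x] is paid. *)
Lemma noisy_minimizer_excess (p fs x f0 : 'rV[R]_d) (c gamma e : R) :
  (forall f, ridge A rho p <= ridge A rho f + gamma) ->
  (forall f y, A (f + y) + A (f - y) - 2 * A f <= c * enorm y ^+ 2) ->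
  ridge A rho fs - ridge A rho p <= e ->
  A (fs + x) <= A f0 + rho * enorm f0 ^+ 2 / 2 + 2 * e + 2 * gamma + (c + rho) * enorm x ^+ 2.
Proof.
move=> near smooth exc.
have n1 := near (fs - x); have n2 := near f0; have sm := smooth fs x.
have ge0 : 0 <= rho * (enorm (fs + x) ^+ 2 / 2).
  by rewrite mulr_ge0 ?(ltW rho_gt0) // divr_ge0 ?sqr_ge0.
(* The second difference of the ridge term is exact and adds [rho] to the smoothness constant. *)
have par : rho * (enorm (fs + x) ^+ 2 / 2) + rho * (enorm (fs - x) ^+ 2 / 2) =
    2 * (rho * (enorm fs ^+ 2 / 2)) + rho * enorm x ^+ 2.
  by rewrite !sqr_enormD enormN dotpNr; field.
rewrite /ridge in n1 n2 exc *; lra.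
Qed.

End PerturbedMinimizer.

(** * Arithmetic of the sample-size condition *)

Section SampleSize.
Variables (R : realType) (CR c4 eta n0 aacc alpha l d Np B : R).
Hypotheses (CR0 : 0 < CR) (eta0 : 0 < eta) (n00 : 0 < n0) (aacc0 : 0 < aacc)
  (alpha0 : 0 < alpha) (l0 : 1 / 2 <= l) (d0 : 0 < d) (Np0 : 0 <= Np) (B0 : 0 < B).
Let rho := aacc / n0 ^+ 2.
Let zeta := rho * B * alpha / (2 * CR).

Lemma sample_size_aggregate :
  256 * (Np + 2) * (CR * n0 ^+ 3 * eta * Np * d * l / (aacc ^+ 2 * alpha)) <= B ->
  eta * (Np * (2 * (2 * (Np + 2) * d * l / zeta))) * n0 <= aacc / 32.
Proof.
rewrite mulrA ler_pdivrMr; last by rewrite mulr_gt0 // exprn_gt0.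
move=> H.
have -> : eta * (Np * (2 * (2 * (Np + 2) * d * l / zeta))) * n0 =
    256 * (Np + 2) * (CR * n0 ^+ 3 * eta * Np * d * l) / (32 * aacc * alpha * B).
  by rewrite /zeta /rho; field; rewrite !gt_eqF.
rewrite ler_pdivrMr ?mulr_gt0 //; apply: le_trans H _.
by rewrite le_eqVlt; apply/orP; left; apply/eqP; field.
Qed.

(** The first condition bounds the ridge part of the second-order noise cost, the other bounds the
    smoothness part, each by [aacc / 8]. *)
Lemma sample_size_output :
  12 * (4 * CR * n0 * d * l ^+ 2 / (aacc * alpha)) <= B ->
  8 * (1 + `|c4|) * (4 * CR `^ (3 / 2) * n0 ^+ 2 * d * l / (aacc `^ (3 / 2) * alpha)) <= B ->
  (2 * CR * `|c4| + rho) * (2 * 2 * d * l / zeta) ^+ 2 <= aacc / 4.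
Proof.
have l_ge : 1 / 2 <= l := l0.
have l_gt0 : 0 < l by apply: lt_le_trans l0; rewrite divr_gt0.
move=> H3 H5.
have xE : 2 * 2 * d * l / zeta = 8 * CR * n0 ^+ 2 * d * l / (aacc * alpha * B).
  by rewrite /zeta /rho; field; rewrite !gt_eqF.
have D0 : 0 < aacc * alpha by rewrite mulr_gt0.
have P0 : 0 < CR * n0 * d * l by rewrite !mulr_gt0.
(* From [l >= 1 / 2], [48 * l >= 24]; the value 23 suffices because [23 ^ 2 >= 8 * 64]. *)
have h3 : 23 * (CR * n0 * d * l) <= B * (aacc * alpha).
  move: H3; rewrite mulrA ler_pdivrMr // => H3; apply: le_trans H3.
  have -> : 12 * (4 * CR * n0 * d * l ^+ 2) = 48 * l * (CR * n0 * d * l) by ring.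
  by rewrite ler_wpM2r ?(ltW P0) //; lra.
have t3 : rho * (2 * 2 * d * l / zeta) ^+ 2 <= aacc / 8.
  have -> : rho * (2 * 2 * d * l / zeta) ^+ 2 =
      64 * aacc * (CR * n0 * d * l) ^+ 2 / (B * (aacc * alpha)) ^+ 2.
    by rewrite xE /rho; field; rewrite !gt_eqF.
  rewrite ler_pdivrMr ?exprn_gt0 ?mulr_gt0 //.
  have : (23 * (CR * n0 * d * l)) ^+ 2 <= (B * (aacc * alpha)) ^+ 2.
    by apply: lerXn2r => //; rewrite nnegrE mulr_ge0 // ltW.
  rewrite exprMn => h; have := ler_wpM2l (ltW aacc0) h.
  have : 0 <= aacc * (CR * n0 * d * l) ^+ 2 by rewrite mulr_ge0 ?(ltW aacc0) ?sqr_ge0.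
  lra.
have pw (x : R) : 0 < x -> (x `^ (3 / 2)) ^+ 2 = x ^+ 3.
  move=> x0; rewrite -powR_mulrn ?powR_ge0 // -powRrM -[RHS]powR_mulrn ?(ltW x0) //.
  by congr (_ `^ _); field.
have t5 : 2 * CR * `|c4| * (2 * 2 * d * l / zeta) ^+ 2 <= aacc / 8.
  have -> : 2 * CR * `|c4| * (2 * 2 * d * l / zeta) ^+ 2 =
      128 * `|c4| * (CR ^+ 3 * (n0 ^+ 2 * d * l) ^+ 2) * aacc / (aacc ^+ 3 * (B * alpha) ^+ 2).
    by rewrite xE; field; rewrite !gt_eqF.
  rewrite ler_pdivrMr ?mulr_gt0 ?exprn_gt0 ?mulr_gt0 //.
  have pa : 0 < aacc `^ (3 / 2) by exact: powR_gt0.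
  move: H5; rewrite mulrA ler_pdivrMr ?mulr_gt0 // => H5.
  have : (8 * (1 + `|c4|) * (4 * CR `^ (3 / 2) * n0 ^+ 2 * d * l)) ^+ 2 <=
      (B * (aacc `^ (3 / 2) * alpha)) ^+ 2.
    apply: lerXn2r => //; rewrite nnegrE.
      by rewrite !mulr_ge0 ?powR_ge0 ?exprn_ge0 ?addr_ge0 ?(ltW n00) ?(ltW d0) ?(ltW l_gt0).
    by rewrite !mulr_ge0 ?powR_ge0 ?(ltW B0) ?(ltW alpha0).
  have -> : (B * (aacc `^ (3 / 2) * alpha)) ^+ 2 = aacc ^+ 3 * (B * alpha) ^+ 2.
    by rewrite -(pw aacc) //; ring.
  have -> : (8 * (1 + `|c4|) * (4 * CR `^ (3 / 2) * n0 ^+ 2 * d * l)) ^+ 2 =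
      1024 * (1 + `|c4|) ^+ 2 * (CR ^+ 3 * (n0 ^+ 2 * d * l) ^+ 2).
    by rewrite -(pw CR) //; ring.
  set Q := CR ^+ 3 * _; set Y := aacc ^+ 3 * _ => h.
  have Q0 : 0 <= Q by rewrite mulr_ge0 ?sqr_ge0 // exprn_ge0 // ltW.
  have c0 : `|c4| <= (1 + `|c4|) ^+ 2.
    by have := normr_ge0 c4; set u := `|c4|; nra.
  have : 1024 * `|c4| * Q <= Y.
    apply: le_trans h; apply: (ler_wpM2r Q0); apply: ler_wpM2l c0; exact: ler0n.
  have := ltW aacc0; move=> a0 h1; have := ler_wpM2l a0 h1; lra.
rewrite mulrDl; lra.
Qed.

End SampleSize.

(** * Excess risk of the private minimizer *)

Section SignedFeatures.
Variables (R : realType) (d : nat).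

Definition signed_feature (z : d.-tuple R * R) : 'rV[R]_d := z.2 *: t2rv z.1.

Lemma measurable_coord_signed_feature : measurable_coord signed_feature.
Proof.
move=> i; apply: (eq_measurable_fun (fun z : d.-tuple R * R => z.2 * tnth z.1 i)).
  by move=> z _; rewrite /signed_feature /t2rv !mxE.
apply: measurable_funM; first exact: measurable_snd.
exact: (measurableT_comp (measurable_tnth i) measurable_fst).
Qed.

Lemma signed_feature_ball (Pxy : probability (d.-tuple R * R)%type R) :
  Pxy [set z | enorm (t2rv z.1) <= 1 /\ (z.2 = 1 \/ z.2 = -1)] = 1%E ->
  Pxy [set z | enorm (signed_feature z) <= 1] = 1%E.
Proof.
move=> supp.
have mS : measurable [set z | enorm (signed_feature z) <= 1].
  apply: measurable_le_real; apply: measurable_enorm; exact: measurable_coord_signed_feature.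
have meq (a : R) : measurable [set z : d.-tuple R * R | z.2 = a].
  have := @measurable_snd _ _ (d.-tuple R) R measurableT [set a] (measurable_set1 a).
  by rewrite setTI.
have mD : measurable [set z : d.-tuple R * R | enorm (t2rv z.1) <= 1 /\ (z.2 = 1 \/ z.2 = -1)].
  rewrite (_ : mkset _ = [set z | enorm (t2rv z.1) <= 1] `&`
    ([set z | z.2 = 1] `|` [set z | z.2 = -1])) //.
  apply: measurableI; last by apply: measurableU; exact: meq.
  apply: measurable_le_real; apply: measurable_enorm => i.
  exact: (measurableT_comp (measurable_coord_t2rv i) measurable_fst).
apply/eqP; rewrite eq_le probability_le1 //= -supp le_measure ?inE //.
move=> z [xz yz] /=; rewrite /signed_feature enormZ.
by case: yz => ->; rewrite ?normrN normr1 mul1r.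
Qed.

End SignedFeatures.

Theorem theorem6 (R : realType) (CR c4 eta : R) (Np : nat) :
  0 < CR -> 0 < eta -> (1 <= Np)%N ->
  exists beta : R, 0 < beta /\
  forall (L : R -> R),
    (* L convex *)
    (forall a b t : R, 0 <= t <= 1 ->
       L (t * a + (1 - t) * b) <= t * L a + (1 - t) * L b) ->
    (* L differentiable, |L'| <= 1, L' is c4-Lipschitz *)
    (forall a : R, derivable L a 1) ->
    (forall a : R, `|derive1 L a| <= 1) ->
    (forall a b : R, `|derive1 L a - derive1 L b| <= c4 * `|a - b|) ->
  forall (d : nat)
    (* the data distribution P^{xy} on {x | ||x|| <= 1} x {-1,1} *)
    (Pxy : probability (d.-tuple R * R)%type R),
    Pxy [set z | enorm (t2rv z.1) <= 1 /\ (z.2 = 1 \/ z.2 = -1)] = 1%E ->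
  let Chat (f : 'rV[R]_d) : \bar R :=
    (CR%:E * \int[Pxy]_z (L (z.2 * dotp f (t2rv z.1)))%:E)%E in
  forall (f0 : 'rV[R]_d) (alpha_acc alpha delta : R) (Bp : nat),
    f0 != 0 ->
    0 < alpha_acc <= 1 -> 0 < alpha <= 1 -> 0 < delta < 1/2 ->
  let n0 := enorm f0 in
  let rho := alpha_acc / n0 ^+ 2 in
  let zeta := rho * Bp%:R * alpha / (2 * CR) in
  forall (fpt : 'rV[R]_d) (fit : 'I_Np -> 'rV[R]_d)
    (d0 : measure_display) (Omega : measurableType d0)
    (P : probability Omega R)
    (* the data set D_p : B_p i.i.d. samples from P^{xy} *)
    (Z : 'I_Bp -> Omega -> (d.-tuple R * R)%type)
    (epsp : Omega -> 'rV[R]_d) (epsi : 'I_Np -> Omega -> 'rV[R]_d)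
    (xi : Omega -> 'rV[R]_d) (fstar : Omega -> 'rV[R]_d),
    (forall j, measurable_fun setT (Z j)) ->
    (forall j (A : set (d.-tuple R * R)%type), measurable A ->
       P (Z j @^-1` A) = Pxy A) ->
    mutually_indep P Z ->
  let Dp := fun w : Omega => [tuple Z j w | j < Bp] in
    (* noises: measurable, Laplace-type density, independent of D_p *)
    measurable_fun setT (@rv2t R d \o epsp) ->
    (forall i, measurable_fun setT (@rv2t R d \o epsi i)) ->
    measurable_fun setT (@rv2t R d \o xi) ->
    has_density_prop_to P epsp (fun v => expR (- (zeta * enorm v))) ->
    (forall i, has_density_prop_to P (epsi i) (fun v => expR (- (zeta * enorm v)))) ->
    has_density_prop_to P xi (fun v => expR (- (zeta * enorm v))) ->
    indep2 P Dp (@rv2t R d \o epsp) ->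
    (forall i, indep2 P Dp (@rv2t R d \o epsi i)) ->
    indep2 P Dp (@rv2t R d \o xi) ->
  (* Z_p(f | D_p) with R(f) = ||f||^2 / 2 *)
  let Zp (w : Omega) (f : 'rV[R]_d) : R :=
    CR / Bp%:R * \sum_(j < Bp) L ((Z j w).2 * dotp f (t2rv (Z j w).1))
    + rho * (enorm f ^+ 2 / 2) in
  let epspi (i : 'I_Np) (w : Omega) := epsp w - epsi i w in
  let Obj (w : Omega) (f : 'rV[R]_d) : R :=
    Zp w f - eta * \sum_(i < Np)
      (dotp (f - 2^-1 *: (fpt + fit i)) (epspi i w)
       + enorm (epspi i w) ^+ 2 / 4) in
    (* f*_p is the (unique) minimizer of Obj, a random vector *)
    measurable_fun setT (@rv2t R d \o fstar) ->
    (forall w g, Obj w (fstar w) <= Obj w g) ->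
  let Vstar := fun w => fstar w + xi w in
  let lnd := ln (d%:R / delta) in
    Bp%:R > beta * Num.max
      (CR * n0 ^+ 3 * eta * Np%:R * d%:R * lnd / (alpha_acc ^+ 2 * alpha))
      (Num.max (CR * n0 ^+ 2 * ln (1 / delta) / alpha_acc ^+ 2)
      (Num.max (4 * CR * n0 * d%:R * lnd ^+ 2 / (alpha_acc * alpha))
      (Num.max (4 * n0 ^+ 3 * eta * Np%:R * d%:R * lnd / (alpha_acc ^+ 2 * alpha))
               (4 * CR `^ (3 / 2) * n0 ^+ 2 * d%:R * lnd
                  / (alpha_acc `^ (3 / 2) * alpha))))) ->
    (P [set w | (Chat (Vstar w) <= Chat f0 + alpha_acc%:E)%E] >= (1 - 3 * delta)%:E)%E.
Proof.
move=> CR0 eta0 _.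
(* [b1] serves the uniform deviation, [b2] the aggregated noise tilting the objective, [b3] and [b4]
   the output noise. Their sum dominates each one, so every needed lower bound on [Bp] follows from
   the single hypothesis. *)
pose b1 : R := 384 * 32 ^+ 2 * CR; pose b2 : R := 256 * (Np%:R + 2).
pose b3 : R := 12; pose b4 : R := 8 * (1 + `|c4|).
have b1_ge0 : 0 <= b1 by rewrite !mulr_ge0 ?exprn_ge0 ?ler0n ?(ltW CR0).
have b2_ge0 : 0 <= b2 by rewrite mulr_ge0 ?addr_ge0 ?ler0n.
have b3_gt0 : 0 < b3 by rewrite ltr0n.
have b4_ge0 : 0 <= b4 by rewrite mulr_ge0 ?addr_ge0 ?ler0n.
exists (b1 + b2 + b3 + b4); split; first by clearbody b1 b2 b3 b4; lra.
move=> L cvx der der1 der2 d Pxy supp Chat f0 aacc alpha delta Bp f0_neq0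
  /andP[a0 a1] /andP[al0 al1] dd n0 rho zeta fpt fit d0 Omega P Z epsp epsi xi fstar
  mZ Zlaw Zind Dp mep mei mxi dep dei dxi _ _ _ Zp epspi Obj mfs fs_min Vstar lnd Bbig.
have [de0 deh] := andP dd.
have n0_gt0 : 0 < n0 by rewrite lt_def enorm_ge0 enorm_eq0 f0_neq0.
have d_gt0 : (0 < d)%N.
  rewrite lt0n; apply/eqP => d_eq0; move: f0_neq0; subst d.
  by rewrite [f0]thinmx0 eqxx.
have dR : (1 : R) <= d%:R by rewrite ler1n.
have inv2 : 2 <= 1 / delta by rewrite ler_pdivlMr //; clear -deh; lra.
have ld : 1 / 2 <= ln (1 / delta) by exact: ln_ge_half.
have lnd_ge : 1 / 2 <= lnd.
  apply: ln_ge_half; apply: le_trans inv2 _.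
  by rewrite ler_pM2r ?invr_gt0.
move: Bbig; set T1 := CR * n0 ^+ 3 * _ * _ * _ * _ / _; set T2 := CR * n0 ^+ 2 * _ / _; set T3 := _ / (aacc * alpha).
set T4 := 4 * n0 ^+ 3 * _ * _ * _ * _ / _; set T5 := 4 * CR `^ _ * _ * _ * _ / _; set M := Num.max _ _ => Bbig.
have T2_ge0 : 0 <= T2.
  apply: divr_ge0; last exact: sqr_ge0.
  apply: mulr_ge0; last by clear -ld; lra.
  by apply: mulr_ge0; [exact: ltW|exact: sqr_ge0].
have T2M : T2 <= M by rewrite /M !le_max lexx ?orbT.
have pick b T : 0 <= b -> b <= b1 + b2 + b3 + b4 -> T <= M -> b * T <= Bp%:R.
  move=> b0 bb TM; apply: le_trans (ltW Bbig).
  apply: le_trans (ler_wpM2l b0 TM) _; rewrite ler_wpM2r //.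
  exact: le_trans T2_ge0 T2M.
have B0 : (0 : R) < Bp%:R.
  apply: le_lt_trans Bbig; rewrite mulr_ge0 //; last exact: le_trans T2_ge0 T2M.
  by clearbody b1 b2 b3 b4; lra.
have H1 : b2 * T1 <= Bp%:R.
  by apply: pick => //; [clearbody b1 b2 b3 b4; lra|rewrite /M !le_max lexx ?orbT].
have H2 : b1 * T2 <= Bp%:R.
  by apply: pick => //; clearbody b1 b2 b3 b4; lra.
have H3 : b3 * T3 <= Bp%:R.
  by apply: pick; [exact: ltW|clearbody b1 b2 b3 b4; lra|rewrite /M !le_max lexx ?orbT].
have H5 : b4 * T5 <= Bp%:R.
  by apply: pick => //; [clearbody b1 b2 b3 b4; lra|rewrite /M !le_max lexx ?orbT].
have rho0 : 0 < rho by rewrite divr_gt0 // exprn_gt0.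
have rhon : rho * n0 ^+ 2 = aacc by rewrite /rho divfK // gt_eqF // exprn_gt0.
have zeta0 : 0 < zeta by apply: divr_gt0; [apply: mulr_gt0 => //; exact: mulr_gt0|exact: mulr_gt0].
have L_lip := loss_lipschitz der der1.
pose V := @signed_feature R d.
have mV : measurable_coord V := @measurable_coord_signed_feature R d.
have muD : Pxy [set z | enorm (V z) <= 1] = 1%E := signed_feature_ball supp.
pose C := mean_loss Pxy V L.
have ChatE f : Chat f = (CR * C f)%:E.
  rewrite /Chat EFinM -(integral_loss mV muD L_lip); congr (_ * _)%E.
  by apply: eq_integral => z _; rewrite /V /signed_feature dotpZr.
pose A f := CR * C f.
have A_low f : CR * L 0 - CR * enorm f <= A f.
  by rewrite -mulrBr ler_pM2l // mean_loss_lower.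
have A_mid f g : A (2^-1 *: (f + g)) <= (A f + A g) / 2.
  by rewrite -mulrDr -mulrA ler_pM2l // mean_loss_midpoint.
have A_smooth f x : A (f + x) + A (f - x) - 2 * A f <= 2 * CR * `|c4| * enorm x ^+ 2.
  have := ler_wpM2l (ltW CR0) (mean_loss_second_difference mV muD L_lip f x
    (loss_second_difference der der2)).
  rewrite -/C /A; lra.
have g0 : 0 < aacc / 32 by rewrite divr_gt0.
have [p near] := ridge_near_min rho0 A_low g0.
(* Chosen so that the deviation of [A], which is [CR] times that of the mean loss, is
   [aacc / 32]. *)
pose tau := aacc / (32 * CR).
have tau0 : 0 < tau by rewrite divr_gt0 // mulr_gt0.
have size1 : 384 * n0 ^+ 2 * ln (1 / delta) <= Bp%:R * tau ^+ 2.
  apply: le_trans (ler_wpM2r (sqr_ge0 tau) H2); rewrite le_eqVlt; apply/orP; left; apply/eqP.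
  by rewrite /b1 /T2 /tau; field; rewrite !gt_eqF.
have [Bad1 [mBad1 PBad1] dev] :=
  uniform_deviation mV muD L_lip mZ Zlaw Zind p n0_gt0 tau0 dd size1.
(* Thresholds of [noise_tail_log] with [m = Np], so that [epsp] and the [Np] noises [epsi] fail
   together with probability at most [delta], and with [m = 0] for [xi]. The deviation event uses
   the third [delta]. *)
pose e0 := 2 * Np.+2%:R * d%:R * lnd / zeta; pose x0 := 2 * 2 * d%:R * lnd / zeta.
have np2 : Np.+2%:R = Np%:R + 2 :> R by rewrite -addn2 natrD.
have size2 : eta * (Np%:R * (2 * e0)) * n0 <= aacc / 32.
  have dd0 : (0 : R) < d%:R by rewrite ltr0n.
  by rewrite /e0 np2; exact: (sample_size_aggregate CR0 n0_gt0 a0 al0 B0 H1).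
have size3 : (2 * CR * `|c4| + rho) * x0 ^+ 2 <= aacc / 4.
  have dd0 : (0 : R) < d%:R by rewrite ltr0n.
  exact: (sample_size_output CR0 n0_gt0 a0 al0 lnd_ge dd0 B0 H3 H5).
pose Bep := [set w | e0 < enorm (epsp w)].
pose Bei i := [set w | e0 < enorm (epsi i w)].
pose Bxi := [set w | x0 < enorm (xi w)].
have mBep : measurable Bep by apply: measurable_lt_real; apply: measurable_enorm; exact/measurable_coordP.
have mBei i : measurable (Bei i) by apply: measurable_lt_real; apply: measurable_enorm; exact/measurable_coordP.
have mBxi : measurable Bxi by apply: measurable_lt_real; apply: measurable_enorm; exact/measurable_coordP.
have PBep : (P Bep <= (delta / Np.+1%:R)%:E)%E := noise_tail_log Np zeta0 d_gt0 dd dep.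
have PBei i : (P (Bei i) <= (delta / Np.+1%:R)%:E)%E := noise_tail_log Np zeta0 d_gt0 dd (dei i).
have PBxi : (P Bxi <= delta%:E)%E.
  by have := noise_tail_log 0 zeta0 d_gt0 dd dxi; rewrite divr1.
pose Bei_all := \big[setU/set0]_(i < Np) Bei i.
have mBei_all : measurable Bei_all by apply: bigsetU_measurable.
have PBei_all : (P Bei_all <= (\sum_(i < Np) delta / Np.+1%:R)%:E)%E.
  by apply: measure_bigsetU_le.
pose Bad := (Bad1 `|` (Bep `|` Bei_all)) `|` Bxi.
have mBn : measurable (Bep `|` Bei_all) by exact: measurableU.
have mB1n : measurable (Bad1 `|` (Bep `|` Bei_all)) by exact: measurableU.
have mBad : measurable Bad by exact: measurableU.
have PBad : (P Bad <= (3 * delta)%:E)%E.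
  apply: le_trans (measureU2 _ mB1n mBxi) _.
  rewrite (_ : 3 * delta = (delta + (delta / Np.+1%:R + \sum_(i < Np) delta / Np.+1%:R)) + delta).
    rewrite EFinD leeD //; apply: le_trans (measureU2 _ mBad1 mBn) _; rewrite EFinD leeD //.
    by apply: le_trans (measureU2 _ mBep mBei_all) _; rewrite EFinD leeD.
  rewrite sumr_const card_ord -mulr_natl -[Np.+1%:R]natr1.
  by field; rewrite natr1 pnatr_eq0.
have mTarget : measurable [set w | (Chat (Vstar w) <= Chat f0 + aacc%:E)%E].
  rewrite (_ : mkset _ = [set w | A (Vstar w) <= A f0 + aacc]).
    apply: measurable_le_real; apply: measurable_funM => //.
    by apply: measurable_mean_loss => //; apply: measurable_coordD; exact/measurable_coordP.
  by apply/seteqP; split => w /=; rewrite !ChatE -EFinD lee_fin.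
apply: (@le_trans _ _ (P (~` Bad))).
  rewrite probability_setC // EFinB; apply: leeB => //.
apply: le_measure; rewrite ?inE //; first exact: measurableC.
move=> w nBad /=; rewrite !ChatE -EFinD lee_fin.
have dev_w : forall h, enorm h <= n0 -> _ := dev w (fun b => nBad (or_introl (or_introl b))).
have ep_le : enorm (epsp w) <= e0.
  by rewrite leNgt; apply/negP => b; apply: nBad; left; right; left.
have ei_le i : enorm (epsi i w) <= e0.
  rewrite leNgt; apply/negP => b; apply: nBad; left; right; right.
  by rewrite /Bei_all -bigcup_seq; exists i => //=; rewrite mem_index_enum.
have xi_le : enorm (xi w) <= x0.
  by rewrite leNgt; apply/negP => b; apply: nBad; right.
pose E f := CR / Bp%:R * \sum_(j < Bp) L (dotp f (V (Z j w))).
have E_cvx f g t : 0 <= t <= 1 -> E (t *: f + (1 - t) *: g) <= t * E f + (1 - t) * E g.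
  move=> t01; rewrite /E !(mulrCA _ (CR / _)) -mulrDr ler_pM2l ?divr_gt0 //.
  rewrite !big_distrr -big_split /=; apply: ler_sum => j _.
  by rewrite dotpDl !dotpZl cvx.
have E_dev h : enorm h <= n0 -> A (p + h) - A p <= E (p + h) - E p + aacc / 32.
  move=> /dev_w; rewrite -/C sumrB => H.
  have k0 : 0 <= CR / Bp%:R by rewrite divr_ge0 ?ltW.
  have := ler_wpM2l k0 H; rewrite [X in _ <= X]mulrDr [X in _ <= X + _]mulrBr -/(E _) -/(E _).
  rewrite (_ : CR / Bp%:R * (Bp%:R * tau) = aacc / 32); last by rewrite /tau; field; rewrite !gt_eqF.
  rewrite (_ : CR / Bp%:R * (Bp%:R * (C (p + h) - C p)) = A (p + h) - A p) //.
  by rewrite /A; field; rewrite gt_eqF.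
(* The perturbed objective is the ridge objective tilted linearly by [W], plus [k], which does not
   depend on [f] and drops out of the minimization. *)
pose W := \sum_(i < Np) epspi i w.
pose k := eta * \sum_(i < Np) (dotp (2^-1 *: (fpt + fit i)) (epspi i w) - enorm (epspi i w) ^+ 2 / 4).
have ObjE f : Obj w f = ridge E rho f - eta * dotp f W + k.
  have ES : CR / Bp%:R * \sum_(j < Bp) L ((Z j w).2 * dotp f (t2rv (Z j w).1)) = E f.
    by congr (_ * _); apply: eq_bigr => j _; rewrite /V /signed_feature dotpZr.
  rewrite /Obj /Zp ES /ridge -[RHS]addrA; congr (_ + _).
  rewrite /k /W dotp_sumr -!mulrN -mulrDr; congr (_ * _).
  rewrite -!sumrN -big_split /=; apply: eq_bigr => i _.
  by rewrite dotpBl; ring.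
have fs_min_w g : ridge E rho (fstar w) - eta * dotp (fstar w) W <= ridge E rho g - eta * dotp g W.
  by have := fs_min w g; rewrite !ObjE lerD2r.
have W_le : enorm W <= Np%:R * (2 * e0).
  apply: le_trans (ler_enorm_sum _ _) _.
  rewrite mulr_natl -[X in _ *+ X]card_ord -sumr_const; apply: ler_sum => i _.
  apply: le_trans (ler_enormD _ _) _; rewrite enormN.
  have := ei_le i; move: ep_le; clear; move: e0 (enorm _) (enorm _) => *; lra.
have etaW : eta * enorm W * n0 <= aacc / 32.
  apply: le_trans size2; rewrite ler_wpM2r ?(ltW n0_gt0) // ler_wpM2l // ltW //.
have small : eta * enorm W * n0 + aacc / 32 + 2 * (aacc / 32) < rho / 4 * n0 ^+ 2.
  by rewrite [X in _ < X]mulrAC rhon; clear -etaW a0; lra.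
have exc := perturbed_minimizer_excess rho0 (ltW eta0) A_mid E_cvx n0_gt0 near E_dev fs_min_w small.
have := noisy_minimizer_excess rho0 (xi w) f0 near A_smooth exc; rewrite -/n0 rhon.
have xi2 : (2 * CR * `|c4| + rho) * enorm (xi w) ^+ 2 <= aacc / 4.
  apply: le_trans size3; apply: ler_wpM2l.
    by rewrite addr_ge0 ?(ltW rho0) // !mulr_ge0 ?(ltW CR0).
  by apply: lerXn2r => //; rewrite nnegrE ?enorm_ge0 // (le_trans _ xi_le) ?enorm_ge0.
(* In units of [aacc] the budget is [1 / 2] for the ridge at [f0], [4 / 32] for twice the excess,
   [2 / 32] for near-minimality and [1 / 4] for the output noise: [15 / 16] in all. *)
move=> fin; apply: le_trans fin _; rewrite /A; clear -etaW xi2 a0; lra.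
Qed.
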